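(* Let $G=(W,E)$ be a loopless graph (multiple edges allowed) with $k$ connected components and at least one edge. Let $\mathcal{Z}(G)\subset\mathbb{R}^W$ be the zonotope associated to $G$, and let $Z(G):=\mathcal{Z}(G)\cap\mathbb{Z}^W$, which is a polymatroid. The polymatroid Tutte polynomial of $Z(G)$ is given in terms of the classical Tutte polynomial $T_G$ of the graph $G$ by $$\mathscr{T}_{Z(G)}(x,y)=(x+y-1)^k\,T_G(x+y,1).$$ Equivalently, $$\mathscr{T}_{Z(G)}(x,y)=\sum_{F}(x+y-1)^{\#\text{connected components of }F},$$ where the sum is over the subsets of edges $F\subseteq E$ such that the subgraph $G_F=(W,F)$ has no cycle (and the connected components of $F$ are those of $(W,F)$).
   Context: Zonotope: $\mathcal{Z}(G)=\sum_{\{i,j\}\subseteq W}m_{\{i,j\}}[\mathbf e_i,\mathbf e_j]$ (Minkowski sum of segments), where $m_{\{i,j\}}$ is the number of edges of $G$ with endpoints $i,j$ and $(\mathbf e_i)_{i\in W}$ is the canonical basis of $\mathbb{R}^W$. Classical Tutte polynomial: $T_G(x,y)=\sum_{S\subseteq E}(x-1)^{c(S)-c(E)}(y-1)^{|S|+c(S)-|W|}$, where $c(S)$ is the number of connected components of $(W,S)$. A polymatroid in $\mathbb{Z}^W$ is a finite nonempty set $P\subset\mathbb{Z}^W$ such that for any $\mathbf a,\mathbf b\in P$ and $i$ with $a_i>b_i$ there is $j$ with $a_j<b_j$ and $\mathbf a-\mathbf e_i+\mathbf e_j,\ \mathbf b+\mathbf e_i-\mathbf e_j\in P$. Polymatroid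 Tutte polynomial: fix any total order on the index set $W$ (the result does not depend on it). For $\mathbf a\in P$, an index $i$ is internally active if there is no $j<i$ with $\mathbf a-\mathbf e_i+\mathbf e_j\in P$, and externally active if there is no $j<i$ with $\mathbf a+\mathbf e_i-\mathbf e_j\in P$; $\mathrm{Int}(\mathbf a),\mathrm{Ext}(\mathbf a)$ are the sets of such indices, and $$\mathscr{T}_P(x,y)=\sum_{\mathbf a\in P}x^{|\mathrm{Int}(\mathbf a)\setminus\mathrm{Ext}(\mathbf a)|}\,y^{|\mathrm{Ext}(\mathbf a)\setminus\mathrm{Int}(\mathbf a)|}\,(x+y-1)^{|\mathrm{Int}(\mathbf a)\cap\mathrm{Ext}(\mathbf a)|}.$$ *)

(* Defs.v *)
From HB Require Import structures.
From mathcomp Require Import all_boot all_order all_algebra.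
From mathcomp Require Import boolp classical_sets cardinality fsbigop reals.
From mathcomp Require Import mpoly.

Set Implicit Arguments.
Unset Strict Implicit.
Unset Printing Implicit Defensive.

Import Order.TTheory GRing.Theory Num.Theory.

Local Open Scope classical_set_scope.
Local Open Scope ring_scope.

(* Finite multigraphs with vertex set W and edge set E; distinct edges may
   have the same endpoints, and an edge with a single endpoint is a loop. *)
Record multigraph (W E : finType) := Multigraph {
  ends : E -> {set W};
  ends_card : forall e, (0 < #|ends e| <= 2)%N
}.

Definition loopless (W E : finType) (G : multigraph W E) : Prop :=
  forall e, #|ends G e| = 2%N.

Definition adjacent (W E : finType) (G : multigraph W E) (F : {set E}) :
    rel W :=
  fun i j => [exists e in F, ends G e == [set i; j]%SET].

Definition components (W E : finType) (G : multigraph W E) (F : {set E}) :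
    nat :=
  n_comp (adjacent G F) W.

(* The sequence (v_0, e_0), ..., (v_(l-1), e_(l-1)) with l >= 1 is a cycle of
   (W, F) when the v_i are distinct, the e_i are distinct edges of F, and e_i
   joins v_i to v_(i+1 mod l). Loops (l = 1) and pairs of parallel edges
   (l = 2) count as cycles. *)
Definition graph_cycle (W E : finType) (G : multigraph W E) (F : {set E})
    (c : seq (W * E)) : bool :=
  [&& c != [::], uniq (unzip1 c), uniq (unzip2 c),
      all (fun e => e \in F) (unzip2 c) &
      cycle (fun a b : W * E => ends G a.2 == [set a.1; b.1]%SET) c].

Definition acyclic (W E : finType) (G : multigraph W E) (F : {set E}) : Prop :=
  forall c, ~~ graph_cycle G F c.

Definition varx : {mpoly int[2]} := 'X_ord0.
Definition vary : {mpoly int[2]} := 'X_ord_max.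

(* The truncated subtractions of nat are exact here, since
   c(S) >= c(E) and |S| + c(S) >= |W| for all S. *)
Definition tutte (W E : finType) (G : multigraph W E) : {mpoly int[2]} :=
  \sum_(S : {set E})
    (varx - 1) ^+ (components G S - components G [set: E]%SET) *
    (vary - 1) ^+ (#|S| + components G S - #|W|).

Definition basis_vec (K : pzRingType) (W : finType) (i : W) : {ffun W -> K} :=
  [ffun j => (j == i)%:R].

Definition segment (R : realType) (V : lmodType R) (u v : V) : set V :=
  [set (1 - t) *: u + t *: v | t in [set t : R | 0 <= t <= 1]].

Definition minkowski_sum (V : nmodType) (I : finType) (D : {set I})
    (A : I -> set V) : set V :=
  [set \sum_(i in D) f i
    | f in [set f : I -> V | forall i, i \in D -> A i (f i)]].

(* [e_i, e_j] for p = {i, j}; the values are in R^o so that {ffun W -> R^o}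
   is canonically a vector space over R. *)
Definition edge_segment (R : realType) (W : finType) (p : {set W}) :
    set {ffun W -> R^o} :=
  [set x | exists i j, p = [set i; j]%SET /\
                       segment (basis_vec R^o i) (basis_vec R^o j) x].
Arguments edge_segment R {W} p _.

Definition multiplicity (W E : finType) (G : multigraph W E) (p : {set W}) :
    nat :=
  #|[set e | ends G e == p]%SET|.

Definition zonotope (R : realType) (W E : finType) (G : multigraph W E) :
    set {ffun W -> R^o} :=
  minkowski_sum [set p : {set W} | #|p| == 2%N]%SET
    (fun p => [set (multiplicity G p)%:R *: x | x in edge_segment R p]).
Arguments zonotope R {W E} G _.

Definition zonotope_lattice (R : realType) (W E : finType)
    (G : multigraph W E) : set {ffun W -> int} :=
  [set a | zonotope R G [ffun i => (a i)%:~R]].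

Definition polymatroid (W : finType) (P : set {ffun W -> int}) : Prop :=
  [/\ finite_set P, P !=set0 &
      forall a b, P a -> P b -> forall i, b i < a i ->
      exists j, [/\ a j < b j,
                    P (a - basis_vec int i + basis_vec int j) &
                    P (b + basis_vec int i - basis_vec int j)]].

Definition Int_active (d : Order.disp_t) (W : finOrderType d)
    (P : set {ffun W -> int}) (a : {ffun W -> int}) : {set W} :=
  [set i | `[< ~ exists j : W,
                 (j < i)%O /\ P (a - basis_vec int i + basis_vec int j) >]]%SET.

Definition Ext_active (d : Order.disp_t) (W : finOrderType d)
    (P : set {ffun W -> int}) (a : {ffun W -> int}) : {set W} :=
  [set i | `[< ~ exists j : W,
                 (j < i)%O /\ P (a + basis_vec int i - basis_vec int j) >]]%SET.

(* The sum over a classical set is meaningful when P is finite, in particular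
   when P is a polymatroid; the total order on the indices is that of W. *)
Definition polymatroid_tutte (d : Order.disp_t) (W : finOrderType d)
    (P : set {ffun W -> int}) : {mpoly int[2]} :=
  \sum_(a \in P)
    varx ^+ #|Int_active P a :\: Ext_active P a| *
    vary ^+ #|Ext_active P a :\: Int_active P a| *
    (varx + vary - 1) ^+ #|Int_active P a :&: Ext_active P a|.

(* Main.v *)
Require Import Defs.
From HB Require Import structures.
From mathcomp Require Import all_boot all_order all_algebra.
From mathcomp Require Import boolp classical_sets functions cardinality.
From mathcomp Require Import fsbigop reals.
From mathcomp Require Import mpoly.
From mathcomp Require Import zify ring lra.
(* Last, so that their names take precedence over those of classical sets. *)
From mathcomp Require Import fintype finset.

Set Implicit Arguments.
Unset Strict Implicit.
Unset Printing Implicit Defensive.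

Import Order.TTheory GRing.Theory Num.Theory.

Local Open Scope ring_scope.

(** Write [q = x + y - 1]. The lattice points of the zonotope are the indegree
    vectors of the orientations of the graph. They are also the integer points
    of the base polytope of the supermodular function sending a set [S] of
    vertices to the number of edges inside [S] ([zonotope_lattice_base]), and
    uncrossing tight sets gives the exchange property ([base_exchange]).

    The activities depend on a total order of the vertices, and deleting or
    contracting an edge interacts badly with that order. The proof therefore
    starts by rewriting the polymatroid Tutte polynomial in an order-free way.
    Put [x = 1 / (1 - u)] and [y = 1 / (1 - v)]. For an integer vector [c] let
    the excess and the deficiency of [c] be the total amounts by which a point
    of the polymatroid closest to [c] lies above, respectively below, [c].
    Then the Tutte polynomial is the sum over all integer vectors [c] of
    [u ^ excess * v ^ deficiency] ([point_sum_cones]). Indeed, attach to each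
    point [a] the cone of the [c] that differ from [a] only downwards at
    internally active indices and upwards at externally active ones. These
    cones tile the integer lattice, each [c] lies in the cone of a closest
    point, and the contribution of a cone is a product over the indices of
    factors [x], [y], [q] or [1]. By a min-max argument the excess of [c] is
    the maximum over [S] of [f S - c S] for the supermodular [f].

    This sum satisfies a deletion-contraction recurrence ([point_sum_edge]).
    On a line [c + t (e_i - e_j)] the excess is [max (A - t, B, C + t)]: it
    decreases with slope one, is constant, and increases with slope one.
    Adding an edge [ij] lengthens the constant stretch by one point and leaves
    the rest unchanged; the additional point carries the weight that the
    contracted graph gives to the image of the line. The sum over forests
    satisfies the same recurrence, and both sides are [q ^ |W|] without edges
    ([point_sum_forests]).

    To avoid infinite series, [u] and [v] are taken nilpotent in a commutative
    ring, so that almost all terms vanish. This loses nothing: for odd [x] the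
    element [1 - 1 / x] is nilpotent modulo every power of [2], so an identity
    valid in all such rings holds at all pairs of odd naturals, hence as an
    identity of polynomials ([mpoly2_separated]).

    Finally, at [y = 1] the classical Tutte polynomial keeps exactly the terms
    with [|S| + c(S) = |W|], which are the forests ([acyclicP]). *)

(** * Finitely supported sums over integer points *)

Section IntegerPoints.
Variable V : finType.
Implicit Types (c a b : {ffun V -> int}) (S T : {set V}) (N : nat).

Definition box_point N (k : {ffun V -> 'I_(2 * N).+1}) : {ffun V -> int} :=
  [ffun i => (k i)%:Z - N%:Z].

Lemma box_point_inj N : injective (@box_point N).
Proof.
move=> k l /ffunP kl; apply/ffunP => i; apply: val_inj => /=.
by have := kl i; rewrite !ffunE; lia.
Qed.

Lemma box_pointP N c :
  (forall i, `|c i| <= N%:Z) -> exists k, c = @box_point N k.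
Proof.
move=> cN; exists [ffun i => inord (absz (c i + N%:Z))]; apply/ffunP => i.
rewrite !ffunE inordK; have := cN i; lia.
Qed.

Lemma finite_box (P : set {ffun V -> int}) N :
  (forall c, P c -> forall i, `|c i| <= N%:Z) -> finite_set P.
Proof.
move=> PN; apply: (@sub_finite_set _ _ (range (@box_point N))); last first.
  exact/finite_image/finite_finset.
by move=> c /PN /box_pointP[k ->]; exists k.
Qed.

Section Sums.
Variable A : comNzRingType.
Implicit Types F H : {ffun V -> int} -> A.

(** Finite support in the explicit form that lets a sum over all integer
    vectors be computed as a sum over a finite type. *)
Definition boxed N F := forall c, F c <> 0 -> forall i, `|c i| <= N%:Z.

Lemma fsum_box N F : boxed N F ->
  \sum_(c \in [set: {ffun V -> int}]%classic) F c = \sum_k F (@box_point N k).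
Proof.
move=> FN; rewrite [RHS]fsbig_seq ?index_enum_uniq //.
rewrite -(@fsbig_widen _ _ 0 +%R (range (@box_point N))%classic
  [set: _]%classic) //=.
  rewrite fsbig_image; last by move=> k l _ _ /box_point_inj.
  by apply: eq_fsbigl; apply/seteqP; split=> k //= _; rewrite mem_index_enum.
move=> c [_ /=]; apply: contra_notP => /FN /box_pointP[k ->].
by exists k.
Qed.

Lemma boxedW {N M F} : (N <= M)%N -> boxed N F -> boxed M F.
Proof. by move=> NM FN c /FN cN i; have := cN i; lia. Qed.

Lemma fsumD N M F H : boxed N F -> boxed M H ->
  \sum_(c \in [set: {ffun V -> int}]%classic) (F c + H c) =
  \sum_(c \in [set: {ffun V -> int}]%classic) F c +
  \sum_(c \in [set: {ffun V -> int}]%classic) H c.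
Proof.
move=> /(boxedW (leq_maxl N M)) FN /(boxedW (leq_maxr N M)) HM.
rewrite (fsum_box FN) (fsum_box HM) -big_split; apply: fsum_box => c FH.
have [F0|/FN //] := pselect (F c = 0).
by apply: HM => H0; apply: FH; rewrite F0 H0 addr0.
Qed.

Lemma fsum_exchange (I : eqType) (r : seq I) N (F : I -> {ffun V -> int} -> A) :
  {in r, forall i, boxed N (F i)} ->
  \sum_(c \in [set: {ffun V -> int}]%classic) \sum_(i <- r) F i c =
  \sum_(i <- r) \sum_(c \in [set: {ffun V -> int}]%classic) F i c.
Proof.
move=> FN; rewrite [RHS]big_seq.
under [RHS]eq_bigr => i ir do rewrite (fsum_box (FN i ir)).
rewrite -big_seq [RHS]exchange_big (@fsum_box N) // => c Fc i.
have [//|/negP cN] := boolP (`|c i| <= N%:Z).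
by case: Fc; apply: big1_seq => j jr; apply: contra_notP cN => /(FN j jr).
Qed.

Lemma fsum_translate F a :
  \sum_(c \in [set: {ffun V -> int}]%classic) F (c + a) =
  \sum_(c \in [set: {ffun V -> int}]%classic) F c.
Proof.
rewrite [RHS](@reindex_fsbigT _ _ _ _ _ (fun c => c + a)) //.
by exists (fun c => c - a) => c; rewrite ?addrK ?subrK.
Qed.

(** Distributivity of a product over sums, which is available over a finite
    index type once all factors are truncated to a common interval. *)
Lemma fsum_prod N (h : V -> int -> A) :
  (forall i t, N%:Z < `|t| -> h i t = 0) ->
  \sum_(c \in [set: {ffun V -> int}]%classic) \prod_i h i (c i) =
  \prod_i \sum_(k < (2 * N).+1) h i (k%:Z - N%:Z).
Proof.
move=> hN; rewrite (@fsum_box N) => [|c hc i].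
  rewrite bigA_distr_bigA; apply: eq_bigr => k _; apply: eq_bigr => i _.
  by rewrite ffunE.
rewrite leNgt; apply/negP => ciN; case: hc.
by rewrite (bigD1 i) //= hN // mul0r.
Qed.

End Sums.
End IntegerPoints.

(** * Base polytopes of supermodular functions *)

Section Base.
Variable V : finType.
Implicit Types (a b c : {ffun V -> int}) (S T : {set V}) (i j k : V).

Definition mass c S : int := \sum_(i in S) c i.

Lemma massD a b S : mass (a + b) S = mass a S + mass b S.
Proof. by rewrite -big_split; apply: eq_bigr => i _; rewrite ffunE. Qed.

Lemma massN a S : mass (- a) S = - mass a S.
Proof. by rewrite -sumrN; apply: eq_bigr => i _; rewrite ffunE. Qed.

Lemma massB a b S : mass (a - b) S = mass a S - mass b S.
Proof. by rewrite massD massN. Qed.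

Lemma mass_basis i S : mass (basis_vec int i) S = (i \in S)%:R.
Proof.
rewrite /mass; under eq_bigr do rewrite ffunE.
have [iS|iS] := boolP (i \in S); last first.
  by rewrite big1 // => j jS; rewrite [_ == _](negPf (memPn iS j jS)).
rewrite (bigD1 i iS) /= eqxx big1 ?addr0 // => j /andP[_ /negPf] ->.
by [].
Qed.

Lemma massUI c S T : mass c (S :|: T) + mass c (S :&: T) = mass c S + mass c T.
Proof.
rewrite /mass (big_setID S) /= setUK setDUl setDv set0U.
by rewrite [X in _ = _ + X](big_setID S) /= [T :&: S]setIC; ring.
Qed.

Lemma massT c : mass c [set: V] = \sum_i c i.
Proof. by apply: eq_bigl => i; rewrite inE. Qed.

Lemma massD1 c i : mass c setT = c i + mass c (~: [set i]).
Proof.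
rewrite /mass (bigD1 i) ?inE //=; congr +%R; apply: eq_bigl => j.
by rewrite !inE.
Qed.

Definition supermodular (f : {set V} -> int) : Prop :=
  forall S T, f S + f T <= f (S :|: T) + f (S :&: T).

Definition base (f : {set V} -> int) : set {ffun V -> int} :=
  fun a => mass a setT = f setT /\ forall S, f S <= mass a S.

Section Supermodular.
Variable f : {set V} -> int.

(** The inequalities for a singleton and for its complement bound each
    coordinate from both sides. *)
Lemma base_bounded : exists N, forall a, base f a -> forall i, `|a i| <= N%:Z.
Proof.
exists (\sum_i (absz (f [set i]) + absz (f setT - f (~: [set i]))))%N.
move=> a [aT aS] i; rewrite (bigD1 i) //=.
have := aS [set i]; rewrite {1}/mass big_set1.
have := aS (~: [set i]); have := massD1 a i; rewrite aT; lia.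
Qed.

Lemma finite_base : finite_set (base f).
Proof. by have [N /finite_box] := base_bounded. Qed.

Definition tight a S := mass a S == f S.

(** Moving a unit from [i] to [j] lowers only the masses of the sets that
    contain [i] and avoid [j], so it is blocked precisely by such a set being
    tight. *)
Lemma base_shift a i j : base f a ->
  base f (a - basis_vec int i + basis_vec int j) <->
  forall S, i \in S -> j \notin S -> ~~ tight a S.
Proof.
move=> [aT aS]; rewrite /base /tight; split=> [[_ bS] S iS jS|nt].
  by have := bS S; rewrite massD massB !mass_basis iS (negPf jS); lia.
split=> [|S]; first by rewrite massD massB !mass_basis !inE; lia.
rewrite massD massB !mass_basis; have := aS S; have := nt S.
by case: (i \in S); case: (j \in S) => //=; lia.
Qed.

Hypotheses (f_super : supermodular f) (f0 : f set0 = 0).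

(** Uncrossing: supermodularity of [f] and modularity of the mass squeeze both
    inequalities, for the union and for the intersection, into equalities. *)
Lemma tightUI a S T : base f a -> tight a S -> tight a T ->
  tight a (S :|: T) && tight a (S :&: T).
Proof.
move=> [_ aS] /eqP tS /eqP tT; rewrite /tight.
have := massUI a S T; have := f_super S T.
have := aS (S :|: T); have := aS (S :&: T); lia.
Qed.

Lemma tight_bigcup a (I : finType) (P : pred I) (F : I -> {set V}) :
  base f a -> (forall x, P x -> tight a (F x)) ->
  tight a (\bigcup_(x | P x) F x).
Proof.
move=> fa tF; apply: (big_ind (tight a)) => //.
  by rewrite /tight f0 /mass big_set0.
by move=> S T tS tT; have /andP[] := tightUI fa tS tT.
Qed.

Lemma tight_bigcap a (I : finType) (P : pred I) (F : I -> {set V}) :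
  base f a -> (forall x, P x -> tight a (F x)) ->
  tight a (\bigcap_(x | P x) F x).
Proof.
move=> fa tF; apply: (big_ind (tight a)) => //.
  by rewrite /tight; case: fa => ->.
by move=> S T tS tT; have /andP[] := tightUI fa tS tT.
Qed.

(** Let [X] be the smallest set tight for [a] containing [i], and [Y] the
    largest set tight for [b] avoiding [i]. The exchange with [j] is legal on
    both sides when [j] lies in [X] outside [Y]. If [a] were at least [b] on
    all of this difference, then, being larger at [i], it would contradict
    supermodularity of [f] on [X] and [Y]. *)
Lemma base_exchange a b i : base f a -> base f b -> b i < a i ->
  exists j, [/\ a j < b j,
                base f (a - basis_vec int i + basis_vec int j) &
                base f (b + basis_vec int i - basis_vec int j)].
Proof.
move=> fa fb ba.
pose X := \bigcap_(S : {set V} | tight a S && (i \in S)) S.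
pose Y := \bigcup_(S : {set V} | tight b S && (i \notin S)) S.
have tX : tight a X by apply: tight_bigcap => // S /andP[].
have tY : tight b Y by apply: tight_bigcup => // S /andP[].
have iX : i \in X by apply/bigcapP => S /andP[].
have iY : i \notin Y by apply/bigcupP => -[S /andP[_ /negPf ->]].
have [[j [jX jY ab]]|nj] :=
    pselect (exists j, [/\ j \in X, j \notin Y & a j < b j]).
  exists j; split=> //.
    apply/(base_shift _ _ fa) => S iS jS; apply/negP => tS.
    by move/bigcapP: jX => /(_ S); rewrite tS iS (negPf jS) => /(_ isT).
  rewrite addrAC; apply/(base_shift _ _ fb) => S jS iS; apply/negP => tS.
  by case/negP: jY; apply/bigcupP; exists S => //; rewrite tS iS.
have : mass b (X :\: Y) < mass a (X :\: Y).
  rewrite /mass (bigD1 i) /= ?inE ?iX ?iY //.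
  rewrite [X in _ < X](bigD1 i) /= ?inE ?iX ?iY //.
  apply: ltr_leD => //; apply: ler_sum => j.
  rewrite inE => /andP[/andP[jY jX] _].
  by rewrite leNgt; apply/negP => ab; apply: nj; exists j.
have massXY c : mass c (X :\: Y) = mass c X - mass c (X :&: Y).
  by rewrite /mass [in RHS](big_setID Y) /=; ring.
move: (f_super X Y) (massUI b X Y) tX tY; rewrite /tight !massXY.
case: fa => _ /(_ (X :&: Y)); case: fb => _ /(_ (X :|: Y)).
move=> + + + + /eqP + /eqP; lia.
Qed.

End Supermodular.
End Base.

(** * The cone decomposition of the integer lattice *)

Section Cones.
Variables (d : Order.disp_t) (V : finOrderType d).
Implicit Types (a b c : {ffun V -> int}) (S T : {set V}) (i j k : V).

Definition rank i : int := #|[set j : V | (j <= i)%O]|%:Z.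

Lemma rank_gt0 i : 0 < rank i.
Proof. by rewrite ltz_nat card_gt0; apply/set0Pn; exists i; rewrite inE. Qed.

Lemma rank_lt i j : (i < j)%O -> rank i < rank j.
Proof.
move=> ij; rewrite ltz_nat; apply: proper_card; apply/properP; split.
  by apply/subsetP => k; rewrite !inE => /le_trans; apply; exact: ltW.
by exists j; rewrite !inE ?lexx // -ltNge.
Qed.

(** The l1 distance to [c] with positive weights that increase along the
    order. Minimising it breaks ties between closest points: a deviation from
    [c] costs less at a smaller index, which is what activity looks at. *)
Definition potential a c : int := \sum_i rank i * `|a i - c i|.

Lemma potential_ge0 a c : 0 <= potential a c.
Proof. by apply: sumr_ge0 => i _; rewrite mulr_ge0 // ltW // rank_gt0. Qed.

Lemma shiftE a i j k :
  (a - basis_vec int i + basis_vec int j) k = a k - (k == i)%:Z + (k == j)%:Z.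
Proof. by rewrite !ffunE !natz. Qed.

Lemma potential_shift a c i j : i != j ->
  potential (a - basis_vec int i + basis_vec int j) c = potential a c +
    rank i * (`|a i - 1 - c i| - `|a i - c i|) +
    rank j * (`|a j + 1 - c j| - `|a j - c j|).
Proof.
move=> ij; rewrite /potential (bigD1 i) // (bigD1 j) 1?eq_sym //=.
rewrite [in RHS](bigD1 i) // [in RHS](bigD1 j) 1?eq_sym //= !shiftE !eqxx.
rewrite (negPf ij) eq_sym (negPf ij) !(subr0, addr0).
rewrite (eq_bigr (fun k => rank k * `|a k - c k|)); first by ring.
by move=> k /andP[ki kj]; rewrite shiftE (negPf ki) (negPf kj) subr0 addr0.
Qed.

(** Convexity: an exchange brings two points closer to each other
    coordinatewise, and the potential is a sum of convex functions of the
    coordinates. *)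
Lemma potential_exchange a b c i j : b i < a i -> a j < b j ->
  potential (a - basis_vec int i + basis_vec int j) c +
  potential (b + basis_vec int i - basis_vec int j) c <=
  potential a c + potential b c.
Proof.
move=> ba ab; rewrite -!big_split /=; apply: ler_sum => k _.
rewrite -!mulrDr; apply: ler_wpM2l; first exact/ltW/rank_gt0.
rewrite [b + _ - _]addrAC !shiftE.
have [->|ki] := eqVneq k i; have [|kj] := eqVneq _ j => //=; try lia.
by move=> ->; lia.
Qed.

Section Supermodular.
Variable f : {set V} -> int.

Definition in_cone a c := [forall i,
  ((c i < a i) ==> (i \in Int_active (base f) a)) &&
  ((a i < c i) ==> (i \in Ext_active (base f) a))].

Lemma in_coneP a c i : in_cone a c ->
  (c i < a i -> i \in Int_active (base f) a) /\
  (a i < c i -> i \in Ext_active (base f) a).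
Proof. by move=> /forallP /(_ i) /andP[/implyP ? /implyP]. Qed.

Lemma Int_activeP a i :
  reflect (forall j, (j < i)%O ->
             ~ base f (a - basis_vec int i + basis_vec int j))
          (i \in Int_active (base f) a).
Proof.
rewrite inE; apply: (iffP (asboolP _)) => [nP j ji Pj|nP [j [ji /(nP j ji)]]//].
by apply: nP; exists j.
Qed.

Lemma Ext_activeP a i :
  reflect (forall j, (j < i)%O ->
             ~ base f (a - basis_vec int j + basis_vec int i))
          (i \in Ext_active (base f) a).
Proof.
rewrite inE; apply: (iffP (asboolP _)) => [nP j ji|nP [j []]].
  by rewrite addrAC => Pj; apply: nP; exists j.
by rewrite addrAC => /nP.
Qed.

(** Moving a unit from [i] to [j] would improve both coordinates. Whichever of
    the two indices is the larger, its activity forbids the move. *)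
Lemma cone_opposite a c i j : in_cone a c -> c i < a i -> a j < c j ->
  ~ base f (a - basis_vec int i + basis_vec int j).
Proof.
move=> ac ci cj; have [+ _] := in_coneP i ac; have [_ +] := in_coneP j ac.
move=> /(_ cj) /Ext_activeP jE /(_ ci) /Int_activeP iI.
have [/jE //|/iI //|eij] := ltgtP i j; by move: ci; rewrite eij; lia.
Qed.

(** A legal move that improves the coordinate [i] worsens a coordinate [j]. As
    [i] is active, [j] is larger and has more weight; the case of an improved
    coordinate [j] is symmetric. *)
Lemma cone_local_min a c i j : in_cone a c -> i != j ->
  base f (a - basis_vec int i + basis_vec int j) ->
  potential a c < potential (a - basis_vec int i + basis_vec int j) c.
Proof.
move=> ac ij fij; rewrite potential_shift //.
have := cone_opposite ac _ _ fij; have := rank_gt0 i; have := rank_gt0 j.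
have [+ _] := in_coneP i ac; have [_ +] := in_coneP j ac.
case: (ltP (c i) (a i)) => ci; case: (ltP (a j) (c j)) => cj.
- by move=> _ _ _ _ /(_ isT isT).
- move=> _ /(_ isT) /Int_activeP iI _ _ _.
  have /rank_lt : (i < j)%O by rewrite ltNge le_eqVlt eq_sym (negPf ij);
    apply/negP => /iI.
  have -> : `|a i - 1 - c i| - `|a i - c i| = -1 by lia.
  have -> : `|a j + 1 - c j| - `|a j - c j| = 1 by lia.
  lia.
- move=> /(_ isT) /Ext_activeP jE _ _ _ _.
  have /rank_lt : (j < i)%O by rewrite ltNge le_eqVlt (negPf ij);
    apply/negP => /jE.
  have -> : `|a i - 1 - c i| - `|a i - c i| = 1 by lia.
  have -> : `|a j + 1 - c j| - `|a j - c j| = -1 by lia.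
  lia.
- move=> _ _ _ _ _.
  have -> : `|a i - 1 - c i| - `|a i - c i| = 1 by lia.
  have -> : `|a j + 1 - c j| - `|a j - c j| = 1 by lia.
  have := rank_gt0 i; have := rank_gt0 j; lia.
Qed.

Lemma base_differ a b : base f a -> base f b -> a <> b ->
  exists i, b i < a i.
Proof.
move=> [aT _] [bT _] ab.
have [//|/forallNP ba] := pselect (exists i, b i < a i).
case: ab; apply/ffunP => i; apply/eqP; rewrite eq_le leNgt; apply/andP; split.
  by apply/negP => ?; apply: (ba i).
rewrite leNgt; apply/negP => abi.
have : mass a [set: V] < mass b [set: V]; last by rewrite aT bT ltxx.
rewrite /mass (bigD1 i) ?inE // [ltRHS](bigD1 i) ?inE //=.
by apply: ltr_leD => //; apply: ler_sum => k _; rewrite leNgt; apply/negP/ba.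
Qed.

(** A point of minimal potential works: if an activity failed, the move to a
    smaller index witnessing this would decrease the potential. *)
Lemma cone_exists c : (exists a, base f a) -> exists2 a, base f a & in_cone a c.
Proof.
move=> [a0 fa0]; have [n] := ubnP (absz (potential a0 c)).
elim: n a0 fa0 => // n IHn a fa an.
have [ac|/forallPn[i]] := boolP (in_cone a c); first by exists a.
have decr b : base f b -> potential b c < potential a c ->
    exists2 a, base f a & in_cone a c.
  move=> fb ba; apply: (IHn b fb); have := potential_ge0 b c; lia.
rewrite negb_and !negb_imply => /orP[]/andP[ci].
  case: Int_activeP => // /existsNP[j /not_implyP[ji /contrapT fij]] _.
  apply: (decr _ fij); rewrite potential_shift ?gt_eqF //.
  have := rank_lt ji; have := rank_gt0 j.
  have -> : `|a i - 1 - c i| - `|a i - c i| = -1 by lia.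
  have : `|a j + 1 - c j| - `|a j - c j| <= 1 by lia.
  move: (_ - _) => t; nia.
case: Ext_activeP => // /existsNP[j /not_implyP[ji /contrapT fij]] _.
apply: (decr _ fij); rewrite potential_shift ?lt_eqF //.
have := rank_lt ji; have := rank_gt0 j.
have -> : `|a i + 1 - c i| - `|a i - c i| = -1 by lia.
have : `|a j - 1 - c j| - `|a j - c j| <= 1 by lia.
move: (_ - _) => t; nia.
Qed.

Hypotheses (f_super : supermodular f) (f0 : f set0 = 0).

(** Local minima are strict global minima, as for every separable convex
    function on a polymatroid: exchanging between [a] and a competitor [b]
    raises the potential of [a], hence lowers that of [b] by convexity while
    moving it towards [a]. *)
Lemma cone_global_min a b c : in_cone a c -> base f a -> base f b -> a <> b ->
  potential a c < potential b c.
Proof.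
move=> ac fa; have [n] := ubnP (\sum_i absz (a i - b i)%R)%N.
elim: n b => // n IHn b; rewrite ltnS => dist_ab fb ab.
have [i ba] := base_differ fa fb ab.
have [j [abj fa' fb']] := base_exchange f_super f0 fa fb ba.
have ij : i != j by apply: contraTneq ba => ->; rewrite -leNgt ltW.
have lt_a := cone_local_min ac ij fa'.
have le_ab := potential_exchange c ba abj.
have lt_b : potential (b + basis_vec int i - basis_vec int j) c < potential b c.
  by lia.
have [->//|/eqP ab'] := eqVneq a (b + basis_vec int i - basis_vec int j).
apply: (lt_trans _ lt_b); apply: IHn => //; apply: leq_trans dist_ab.
have b'E k : (b + basis_vec int i - basis_vec int j) k =
    b k - (k == j)%:Z + (k == i)%:Z by rewrite addrAC shiftE.
rewrite (bigD1 i) // [in leqRHS](bigD1 i) //= -addSn; apply: leq_add.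
  by rewrite b'E eqxx (negPf ij); lia.
apply: leq_sum => k /negPf ki; rewrite b'E ki.
by case: eqVneq abj => [->|_ _]; [move: (a j) (b j)|move: (a k) (b k)]; lia.
Qed.

Lemma cone_unique a b c : base f a -> base f b -> in_cone a c -> in_cone b c ->
  a = b.
Proof.
move=> fa fb ac bc; have [//|/eqP ab] := eqVneq a b.
have := cone_global_min ac fa fb ab.
have := cone_global_min bc fb fa (nesym ab); lia.
Qed.

End Supermodular.
End Cones.

(** * Counting lattice points by excess and deficiency *)

Section Excess.
Variable V : finType.
Implicit Types (f : {set V} -> int) (a b c : {ffun V -> int}) (S T : {set V}).

(** For supermodular [f], by min-max, the least total amount by which a point
    of the base polytope exceeds [c]; see [cone_excess] for the closest points
    of the cone decomposition. *)
Definition excess f c : int := \big[Num.max/0]_(S : {set V}) (f S - mass c S).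

Lemma excess_ge f c S : f S - mass c S <= excess f c.
Proof. exact: le_bigmax. Qed.

Lemma excess_ge0 f c : 0 <= excess f c.
Proof. exact: bigmax_ge_id. Qed.

Lemma excess_eq f c m : f set0 = 0 ->
  (forall S, f S - mass c S <= m) -> (exists S, m = f S - mass c S) ->
  excess f c = m.
Proof.
move=> f0 le_m [S mE]; apply: le_anti; apply/andP; split.
  apply: bigmax_le => //.
  by have := le_m set0; rewrite f0 /mass big_set0.
by rewrite mE excess_ge.
Qed.

Section Weight.
Variables (A : comNzRingType) (u v : A).

(** All points of the base polytope have mass [f setT], so the second exponent
    is the deficiency, the total amount by which a closest point stays below
    [c]. *)
Definition weight f c : A :=
  u ^+ absz (excess f c) *
  v ^+ absz (excess f c + mass c [set: V] - f [set: V])%R.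

Definition point_sum f : A :=
  \sum_(c \in [set: {ffun V -> int}]%classic) weight f c.

Variable n : nat.
Hypotheses (un0 : u ^+ n = 0) (vn0 : v ^+ n = 0).

Lemma expr_nil (w : A) m : w ^+ n = 0 -> w ^+ m <> 0 -> (m < n)%N.
Proof.
move=> w0; apply: contra_notT; rewrite -leqNgt => /subnK <-.
by rewrite exprD w0 mulr0.
Qed.

(** A large coordinate, in either direction, forces a large excess or
    deficiency through a singleton or its complement, and then a nilpotent
    factor is zero. *)
Lemma weight_boxed f : exists N, boxed N (weight f).
Proof.
exists (n + \sum_(i : V) (absz (f [set i]) +
                          absz (f [set: V] - f (~: [set i]))%R))%N.
move=> c wc i; have un : u ^+ absz (excess f c) <> 0.
  by apply: contra_not wc => w0; rewrite /weight w0 mul0r.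
have vn : v ^+ absz (excess f c + mass c [set: V] - f [set: V])%R <> 0.
  by apply: contra_not wc => w0; rewrite /weight w0 mulr0.
have := expr_nil un0 un; have := expr_nil vn0 vn.
rewrite (bigD1 i) //= (massD1 c i).
have := excess_ge0 f c.
have := excess_ge f c [set i]; rewrite {1}/mass big_set1.
have := excess_ge f c (~: [set i]).
lia.
Qed.

(** The contribution of one coordinate of [c] at signed distance [t] from
    [a]. *)
Definition step_weight (t : int) : A :=
  match t with Posz m => v ^+ m | Negz m => u ^+ m.+1 end.

Lemma step_weightE (s t : int) :
  u ^+ absz (Num.max 0 (s - t))%R * v ^+ absz (Num.max 0 (t - s))%R =
  step_weight (t - s).
Proof.
rewrite -(opprB t s); case: (t - s) => m /=.
  by rewrite (max_idPl _) ?oppr_le0 // (max_idPr _) // mul1r.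
by rewrite mulr1.
Qed.

Lemma step_weight_nil t : n%:Z < `|t| -> step_weight t = 0.
Proof.
have nil w m : w ^+ n = 0 -> (n <= m)%N -> w ^+ m = 0 :> A.
  by move=> w0 /subnK <-; rewrite exprD w0 mulr0.
by case: t => m /= nm; apply: nil => //; lia.
Qed.

Lemma weight_prod f a c : base f a ->
  excess f c = \sum_i Num.max 0 (a i - c i) ->
  weight f c = \prod_i step_weight (c i - a i).
Proof.
move=> [aT _] exc.
have abszE (F : V -> int) : (forall i, 0 <= F i) ->
    absz (\sum_i F i)%R = (\sum_i absz (F i))%N.
  move=> F0; apply/eqP; rewrite -eqz_nat (big_morph Posz PoszD (erefl _)).
  rewrite gez0_abs ?sumr_ge0 //; apply/eqP/eq_bigr => i _.
  by rewrite gez0_abs.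
have deff : excess f c + mass c [set: V] - f [set: V] =
    \sum_i Num.max 0 (c i - a i).
  rewrite -aT exc !massT -addrA -sumrB -big_split /=.
  apply: eq_bigr => i _; lia.
rewrite /weight deff exc !abszE => [||i]; try lia.
rewrite !expr_sum -big_split; apply: eq_bigr => i _; exact: step_weightE.
Qed.

End Weight.
End Excess.

Section Geometric.
Variables (A : comNzRingType) (u v x y : A) (n : nat).
Hypotheses (un0 : u ^+ n = 0) (vn0 : v ^+ n = 0).
Hypotheses (xu : x * (1 - u) = 1) (yv : y * (1 - v) = 1).

Lemma geometric_sum (w z : A) : w ^+ n = 0 -> z * (1 - w) = 1 ->
  \sum_(0 <= k < n) w ^+ k.+1 = z - 1.
Proof.
move=> wn0 zw; have geo : \sum_(k < n) w ^+ k = z.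
  have geo1 : (1 - w) * \sum_(k < n) w ^+ k = 1.
    by rewrite -[1 - w]opprB mulNr -subrX1 wn0 sub0r opprK.
  by rewrite -[LHS]mul1r -zw -mulrA geo1 mulr1.
rewrite big_mkord; under eq_bigr do rewrite exprS.
have zE : z = 1 + w * z by rewrite -zw; ring.
by rewrite -mulr_sumr geo; apply: (addrI 1); rewrite -zE; ring.
Qed.

(** The one-dimensional cone sums: the directions allowed by internal and
    external activity are the negative and the positive half-line, of sums
    [x - 1] and [y - 1]. *)
Lemma step_sum (I J : bool) :
  \sum_(k < (2 * n).+1)
     (let t := k%:Z - n%:Z in
      if ((t < 0) ==> I) && ((0 < t) ==> J) then step_weight u v t else 0) =
  1 + I%:R * (x - 1) + J%:R * (y - 1).
Proof.
rewrite -(big_mkord xpredT (fun k => let t := k%:Z - n%:Z in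
  if ((t < 0) ==> I) && ((0 < t) ==> J) then step_weight u v t else 0)).
rewrite (@big_cat_nat _ _ _ n) //=; last by lia.
rewrite big_nat_rev [X in _ + X](big_addn 0 _ n).
have -> : ((2 * n).+1 - n = n.+1)%N by lia.
rewrite big_nat_recl //= add0n subrr ltxx /= addrCA addrA; congr (_ + _ + _).
  rewrite -(geometric_sum un0 xu) mulr_sumr; apply: eq_big_nat => k kn.
  have -> : (0 + n - k.+1)%N%:Z - n%:Z = Negz k by lia.
  by case: I; rewrite /= ?mul1r ?mul0r.
rewrite -(geometric_sum vn0 yv) mulr_sumr; apply: eq_big_nat => k kn.
have -> : (k.+1 + n)%N%:Z - n%:Z = k.+1%:Z by lia.
by case: J; rewrite /= ?mul1r ?mul0r.
Qed.

End Geometric.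

Section ConeSum.
Variables (d : Order.disp_t) (V : finOrderType d) (f : {set V} -> int).
Hypotheses (f_super : supermodular f) (f0 : f set0 = 0).
Implicit Types (a b c : {ffun V -> int}) (S T : {set V}).

(** For [i] with [c i < a i] and [j] with [a j < c j], a set containing [i]
    but not [j] is tight for [a], since no unit can move from [i] to [j].
    Suitable unions of intersections of these give one tight set that
    separates all such [i] from all such [j], and it attains the maximum
    defining the excess. *)
Lemma cone_excess a c : base f a -> in_cone f a c ->
  excess f c = \sum_i Num.max 0 (a i - c i).
Proof.
move=> fa ac.
pose sep i j S := [&& tight f a S, i \in S & j \notin S].
have sepP i j : c i < a i -> a j < c j -> exists S, sep i j S.
  move=> ci cj; have := cone_opposite ac ci cj.
  move/(base_shift _ _ fa) /existsNP => [S /not_implyP[iS]].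
  by move=> /not_implyP[jS /negP]; rewrite negbK => tS; exists S; apply/and3P.
pose T i := \bigcap_(j | a j < c j) odflt [set: V] [pick S | sep i j S].
have TP i : c i < a i ->
    [/\ tight f a (T i), i \in T i & forall j, a j < c j -> j \notin T i].
  move=> ci; have pickP j : a j < c j ->
      sep i j (odflt [set: V] [pick S | sep i j S]).
    by case: pickP => //= nS /(sepP _ _ ci)[S]; rewrite nS.
  split; first by apply: tight_bigcap => // j /pickP /and3P[].
    by apply/bigcapP => j /pickP /and3P[].
  move=> j cj; apply/negP => /bigcapP /(_ j cj).
  by have /and3P[_ _ /negPf ->] := pickP j cj.
pose S := \bigcup_(i | c i < a i) T i.
have tS : tight f a S by apply: tight_bigcup => // i /TP[].
have iS i : c i < a i -> i \in S.
  by move=> ci; apply/bigcupP; exists i => //; have [] := TP i ci.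
have jS j : a j < c j -> j \notin S.
  move=> cj; apply/bigcupP => -[i /TP[_ _ /(_ j cj) /negPf ->]] //.
apply: excess_eq => // [U|].
  have [_ /(_ U) fU] := fa; apply: le_trans (lerB fU (lexx _)) _.
  rewrite -sumrB [leRHS](bigID (mem U)) /= -[leLHS]addr0; apply: lerD.
    by apply: ler_sum => i _; lia.
  by apply: sumr_ge0 => i _; lia.
exists S; rewrite -(eqP tS) -sumrB [LHS](bigID (mem S)) /=.
rewrite [X in _ + X]big1 ?addr0 => [|i].
  by apply: eq_bigr => i; have := jS i; lia.
by have := iS i; lia.
Qed.

Variables (A : comNzRingType) (u v x y : A) (n : nat).
Hypotheses (un0 : u ^+ n = 0) (vn0 : v ^+ n = 0).
Hypotheses (xu : x * (1 - u) = 1) (yv : y * (1 - v) = 1).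

Lemma cone_weight_sum a :
  \sum_(c \in [set: {ffun V -> int}]%classic)
    (if in_cone f a c then \prod_i step_weight u v (c i - a i) else 0) =
  \prod_i (1 + (i \in Int_active (base f) a)%:R * (x - 1) +
               (i \in Ext_active (base f) a)%:R * (y - 1)).
Proof.
rewrite -(fsum_translate _ a); pose h i (t : int) : A :=
  if ((t < 0) ==> (i \in Int_active (base f) a)) &&
     ((0 < t) ==> (i \in Ext_active (base f) a))
  then step_weight u v t else 0.
under [RHS]eq_bigr do rewrite -(step_sum un0 vn0 xu yv).
rewrite -(@fsum_prod _ _ n h) => [|i t nt]; last first.
  by rewrite /h (step_weight_nil un0 vn0) ?if_same.
apply: eq_fsbigr => c _; rewrite /in_cone.
have [/forallP ac|/forallPn[i nac]] := ifPn.
  apply: eq_bigr => i _ /=; have := ac i; rewrite !ffunE addrK.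
  by rewrite /h gtrDr ltrDr => ->.
rewrite (bigD1 i) //= {1}/h; move: nac; rewrite !ffunE gtrDr ltrDr.
by move=> /negPf ->; rewrite mul0r.
Qed.

(** The cones tile the lattice, and each contributes a product of
    one-dimensional sums. The order on [V] enters only the right side. *)
Theorem point_sum_cones : (exists a, base f a) ->
  point_sum u v f =
  \sum_(a \in base f)
    \prod_i (1 + (i \in Int_active (base f) a)%:R * (x - 1) +
                 (i \in Ext_active (base f) a)%:R * (y - 1)).
Proof.
move=> f_ex; have fin := finite_base f.
rewrite fsbig_finite //.
have weightE c : weight u v f c =
    \sum_(a <- finmap.enum_fset (fset_set (base f)))
    if in_cone f a c then \prod_i step_weight u v (c i - a i) else 0.
  have [a fa ac] := cone_exists c f_ex.
  rewrite (weight_prod _ _ fa (cone_excess fa ac)).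
  rewrite (bigD1_seq a) ?finmap.fset_uniq ?in_fset_set ?(mem_set fa) //=.
  rewrite ac [X in _ + X]big1_seq ?addr0 // => b.
  rewrite in_fset_set // => /andP[/eqP ba /set_mem fb]; case: ifPn => // bc.
  by case: ba; apply: (cone_unique f_super f0 _ _ bc ac).
have [M baseM] := base_bounded f.
rewrite /point_sum; under eq_fsbigr do rewrite weightE.
rewrite (@fsum_exchange _ _ _ _ (n + M)) => [|a].
  by apply: eq_bigr => a _; exact: cone_weight_sum.
rewrite in_fset_set // => /set_mem fa c ac i; rewrite leNgt; apply/negP => ci.
case: ac; case: ifP => // _; rewrite (bigD1 i) //=.
rewrite (step_weight_nil un0 vn0) ?mul0r //.
by move: ci (baseM a fa i); move: (a i) (c i); lia.
Qed.

End ConeSum.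

(** * Deletion and contraction of an edge *)

Section Loop.
Variables (V : finType) (A : comNzRingType) (u v : A).
Implicit Types (f : {set V} -> int) (S : {set V}).

Lemma weight_eq (V' : finType) f c (f' : {set V'} -> int) c' :
  excess f c = excess f' c' ->
  mass c [set: V] - f [set: V] = mass c' [set: V'] - f' [set: V'] ->
  weight u v f c = weight u v f' c'.
Proof. by move=> exc m; rewrite /weight -!addrA exc m. Qed.

(** A loop translates the base polytope by a unit vector. *)
Lemma point_sum_loop f f1 i : (forall S, f1 S = f S + (i \in S)%:Z) ->
  point_sum u v f1 = point_sum u v f.
Proof.
move=> f1E; rewrite /point_sum.
rewrite -(fsum_translate (weight u v f) (- basis_vec int i)).
apply: eq_fsbigr => c _; apply: weight_eq.
  apply: eq_bigr => S _; rewrite f1E massB mass_basis natz; lia.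
by rewrite f1E massB mass_basis natz inE; lia.
Qed.

End Loop.

(** The map [p] merges [i] into [j], and [s] chooses [j] as the representative
    of the merged element. *)
Lemma contraction_exists (V : finType) (i j : V) : i != j ->
  exists (V' : finType) (p : V -> V') (s : V' -> V),
  [/\ p i = p j, cancel s p & forall x : V, x != i -> s (p x) = x].
Proof.
rewrite eq_sym => ji.
exists {x : V | x != i}, (fun x => insubd (exist _ j ji) x), val.
split=> [|k|x xi]; last by rewrite val_insubd xi.
  by apply: val_inj; rewrite !val_insubd eqxx ji.
by apply: val_inj; rewrite val_insubd (valP k).
Qed.

Lemma card_contraction (V V' : finType) (p : V -> V') (s : V' -> V) (i j : V) :
  i != j -> p i = p j -> cancel s p -> (forall x, x != i -> s (p x) = x) ->
  #|V| = #|V'|.+1.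
Proof.
move=> ij pij sK pK; have si v : s v != i.
  have sj : s (p j) = j by rewrite pK // eq_sym.
  apply: contraNneq ij => svi; have pv : p i = v by rewrite -svi sK.
  by rewrite -[j]sj -pij pv svi eqxx.
have -> : #|V'| = #|[set~ i]|.
  rewrite -cardsT -(card_imset _ (can_inj sK)); apply: eq_card => x.
  rewrite !inE; apply/imsetP/idP => [[v _ ->] //|xi].
  by exists (p x); rewrite ?inE ?pK.
by rewrite cardsC1 prednK //; apply/card_gt0P; exists i.
Qed.

Section Contraction.
Variables (V V' : finType) (p : V -> V') (s : V' -> V) (i j : V).
Hypotheses (i_neq_j : i != j) (p_ij : p i = p j).
Hypotheses (sK : cancel s p) (pK : forall x, x != i -> s (p x) = x).
Implicit Types (c : {ffun V -> int}) (S : {set V}).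

Definition project c : {ffun V' -> int} :=
  [ffun k => mass c (p @^-1: [set k])].

Lemma mass_project c (S' : {set V'}) :
  mass (project c) S' = mass c (p @^-1: S').
Proof.
rewrite /mass [RHS](partition_big p (mem S')) /= => [|x]; last by rewrite inE.
apply: eq_bigr => k kS'; rewrite ffunE; apply: eq_bigl => x; rewrite !inE.
by case: eqP => [->|]; rewrite ?kS' ?andbF.
Qed.

Lemma preim_nonsep S : ((i \in S) == (j \in S)) -> p @^-1: (s @^-1: S) = S.
Proof.
move=> /eqP ij; apply/setP => x; rewrite !inE.
have [->|/pK -> //] := eqVneq x i.
by rewrite p_ij pK ?ij // eq_sym.
Qed.

Lemma fibre_merged : p @^-1: [set p i] = [set i; j].
Proof.
apply/setP => x; rewrite !inE.
have [->|xi] := eqVneq x i; first by rewrite eqxx.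
apply/eqP/eqP => [pxi|->]; last by [].
by rewrite -(pK xi) pxi p_ij pK // eq_sym.
Qed.

Lemma fibre_other x : p x != p i -> p @^-1: [set p x] = [set x].
Proof.
move=> pxi; have xi : x != i by apply: contraNneq pxi => ->.
apply/setP => y; rewrite !inE; apply/eqP/eqP => [pyx|->//].
by rewrite -(pK xi) -pyx pK //; apply: contraNneq pxi => <-; rewrite pyx.
Qed.

(** The multiples of the direction of the lines contracted by [project]. *)
Definition slide (t : int) : {ffun V -> int} :=
  [ffun x => t * (x == i)%:Z - t * (x == j)%:Z].

Lemma mass_slide t S : mass (slide t) S = t * (i \in S)%:Z - t * (j \in S)%:Z.
Proof.
rewrite -!natz -!mass_basis /mass !mulr_sumr -sumrB.
by apply: eq_bigr => x _; rewrite !ffunE !natz.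
Qed.

Lemma project_slide c t : project (c + slide t) = project c.
Proof.
apply/ffunP => k; rewrite !ffunE massD mass_slide !inE p_ij; lia.
Qed.

(** The part of the excess due to the sets that contain [x] and avoid [y]. On
    a line in the direction of [slide] it has slope [-1] for [i, j] and slope
    [1] for [j, i]. The starting value of the maximum is the term of the
    singleton, so that the maximum is attained. *)
Definition sepmax (f : {set V} -> int) (c : {ffun V -> int}) (x y : V) : int :=
  \big[Num.max/f [set x] - mass c [set x]]_(S : {set V}
      | (x \in S) && (y \notin S)) (f S - mass c S).

Lemma sepmax_ge f c x y S : x \in S -> y \notin S ->
  f S - mass c S <= sepmax f c x y.
Proof. by move=> xS yS; apply: (@le_bigmax_cond _ _ _ _ S); rewrite xS. Qed.

Lemma sepmax_witness f c x y : x != y ->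
  exists S, [/\ x \in S, y \notin S & sepmax f c x y = f S - mass c S].
Proof.
move=> xy; rewrite /sepmax.
elim/big_ind: _ => [|m1 m2 w1 w2|S /andP[xS yS]]; last by exists S.
  by exists [set x]; rewrite !inE eqxx eq_sym.
by rewrite maxElt; case: ifP.
Qed.

Lemma sepmax_translate f c c' t x y : x != y ->
  (forall S, x \in S -> y \notin S -> mass c' S = mass c S + t) ->
  sepmax f c' x y = sepmax f c x y - t.
Proof.
move=> xy massE; apply: le_anti; apply/andP; split.
  have [S [xS yS ->]] := sepmax_witness f c' xy.
  by have := sepmax_ge f c xS yS; rewrite massE //; lia.
have [S [xS yS ->]] := sepmax_witness f c xy.
by have := sepmax_ge f c' xS yS; rewrite massE //; lia.
Qed.

Lemma sepmax_slide f c t : sepmax f (c + slide t) i j = sepmax f c i j - t.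
Proof.
apply: sepmax_translate => // S iS /negPf jS.
by rewrite massD mass_slide iS jS; lia.
Qed.

Lemma sepmax_slideC f c t : sepmax f (c + slide t) j i = sepmax f c j i + t.
Proof.
rewrite -[t in RHS]opprK; apply: sepmax_translate => [|S jS /negPf iS].
  by rewrite eq_sym.
by rewrite massD mass_slide iS jS; lia.
Qed.

Variable f : {set V} -> int.
Hypotheses (f_super : supermodular f) (f0 : f set0 = 0).
(* [f] belongs to the graph without the edge [ij], [f1] to the graph with this
   edge, and [fc] to the contraction of the edge. *)
Variable f1 : {set V} -> int.
Hypothesis f1E : forall S, f1 S = f S + ((i \in S) && (j \in S))%:Z.

Let fc (S' : {set V'}) := f (p @^-1: S').

(** The sets that do not separate [i] from [j] are the preimages of the sets
    of merged vertices, so their part of the excess is constant along the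
    lines. The subtracted unit vector accounts for the edge [ij], present in
    [f1]. *)
Let nonsepmax c := excess fc (project (c - basis_vec int i)).

Lemma nonsepmax_ge c S : (i \in S) == (j \in S) ->
  f S - mass c S + (i \in S)%:Z <= nonsepmax c.
Proof.
move=> ij; have := excess_ge fc (project (c - basis_vec int i)) (s @^-1: S).
rewrite mass_project (preim_nonsep ij) massB mass_basis natz.
by rewrite -/(nonsepmax c) {1}/fc (preim_nonsep ij); lia.
Qed.

Lemma nonsepmax_witness c : exists2 S : {set V}, (i \in S) == (j \in S) &
  nonsepmax c = f S - mass c S + (i \in S)%:Z.
Proof.
rewrite /nonsepmax /excess.
elim/big_ind: _ => [|m1 m2 w1 w2|S _].
- by exists set0; rewrite ?inE // f0 /mass big_set0; lia.
- by rewrite maxElt; case: ifP.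
- exists (p @^-1: S); first by rewrite !inE p_ij.
  by rewrite /fc mass_project massB mass_basis natz; lia.
Qed.

(** Uncrossing a set that contains only [i] with one that contains only [j]
    yields two non-separating sets, and their union contains the edge [ij]. It
    follows that the constant stretch of the excess on a line is nonempty. *)
Lemma nonsepmax_dominates c :
  sepmax f c i j + sepmax f c j i + 1 <= 2 * nonsepmax c.
Proof.
have [S [iS jS ->]] := sepmax_witness f c i_neq_j.
have [T [jT iT ->]] : exists T : {set V}, [/\ j \in T, i \notin T &
    sepmax f c j i = f T - mass c T] by apply: sepmax_witness; rewrite eq_sym.
have := @nonsepmax_ge c (S :|: T); have := @nonsepmax_ge c (S :&: T).
rewrite !inE iS jT (negPf jS) (negPf iT) /= => /(_ isT) + /(_ isT).
have := f_super S T; have := massUI c S T; lia.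
Qed.

Lemma excess_edge c : excess f1 c =
  Num.max (nonsepmax c) (Num.max (sepmax f c i j) (sepmax f c j i)).
Proof.
have j_neq_i : j != i by rewrite eq_sym.
apply: excess_eq => [|S|]; first by rewrite f1E !inE f0.
  rewrite f1E; have [iS|iS] := boolP (i \in S);
    have [jS|jS] := boolP (j \in S) => /=.
  - by have := @nonsepmax_ge c S; rewrite iS jS => /(_ isT) /=; lia.
  - by have := sepmax_ge f c iS jS; lia.
  - by have := sepmax_ge f c jS iS; lia.
  - have := @nonsepmax_ge c S; rewrite (negPf iS) (negPf jS) => /(_ isT).
    by move=> /=; lia.
have [S [iS jS SE]] := sepmax_witness f c i_neq_j.
have [T [jT iT TE]] := sepmax_witness f c j_neq_i.
have [U /eqP iU UE] := nonsepmax_witness c.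
rewrite !maxElt; do ?case: ifP => _.
- by exists T; rewrite f1E TE (negPf iT) /=; lia.
- by exists S; rewrite f1E SE (negPf jS) andbF; lia.
- by exists U; rewrite f1E UE -iU andbb; lia.
Qed.

Lemma excess_shift c : excess f (c - basis_vec int i) =
  Num.max (nonsepmax c) (Num.max (sepmax f c i j + 1) (sepmax f c j i)).
Proof.
have j_neq_i : j != i by rewrite eq_sym.
have massE S : mass (c - basis_vec int i) S = mass c S - (i \in S)%:Z.
  by rewrite massB mass_basis natz.
apply: excess_eq => // [S|].
  rewrite massE; have [iS|iS] := boolP (i \in S);
    have [jS|jS] := boolP (j \in S) => /=.
  - by have := @nonsepmax_ge c S; rewrite iS jS => /(_ isT) /=; lia.
  - by have := sepmax_ge f c iS jS; lia.
  - by have := sepmax_ge f c jS iS; lia.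
  - have := @nonsepmax_ge c S; rewrite (negPf iS) (negPf jS) => /(_ isT).
    by move=> /=; lia.
have [S [iS jS SE]] := sepmax_witness f c i_neq_j.
have [T [jT iT TE]] := sepmax_witness f c j_neq_i.
have [U /eqP iU UE] := nonsepmax_witness c.
rewrite !maxElt; do ?case: ifP => _.
- by exists T; rewrite massE TE (negPf iT) /=; lia.
- by exists S; rewrite massE SE iS; lia.
- by exists U; rewrite massE UE; lia.
Qed.

Variables (A : comNzRingType) (u v : A) (n : nat).
Hypotheses (un0 : u ^+ n = 0) (vn0 : v ^+ n = 0).

(** The left end, on a line, of the constant stretch of the excess of [f] at
    [c - e_i]. *)
Let crit c := sepmax f c i j + 1 == nonsepmax c.

(** The closest points for [f1] come from directing the new edge towards [i]
    or towards [j]. To the right of a certain point of each line the first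
    choice is optimal, to its left the second one. *)
Lemma weight_edge c : weight u v f1 c =
  if sepmax f c i j + 1 <= nonsepmax c then weight u v f (c - basis_vec int i)
  else weight u v f (c + slide 1 - basis_vec int i).
Proof.
have dom := nonsepmax_dominates c.
case: leP => cR; apply: weight_eq.
- by rewrite excess_edge excess_shift; lia.
- by rewrite f1E massB mass_basis natz !inE; lia.
- rewrite excess_edge excess_shift sepmax_slide.
  have -> : nonsepmax (c + slide 1) = nonsepmax c.
    by rewrite /nonsepmax addrAC project_slide.
  by rewrite sepmax_slideC; lia.
- by rewrite f1E massB massD mass_slide mass_basis natz !inE; lia.
Qed.

Lemma weight_crit c : crit c ->
  weight u v f (c - basis_vec int i) =
  weight u v fc (project (c - basis_vec int i)).
Proof.
move=> /eqP cE; have := nonsepmax_dominates c => dom; apply: weight_eq.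
  by rewrite excess_shift -/(nonsepmax c); lia.
by rewrite mass_project /fc !preimsetT.
Qed.

(** Every line contains exactly one critical point, because the part of the
    excess from the sets containing only [i] has slope [-1] and the part from
    the non-separating sets is constant. *)
Lemma project_crit_bij :
  set_bij [set c | crit c]%classic [set: {ffun V' -> int}]%classic
    (fun c => project (c - basis_vec int i)).
Proof.
have nonsep_slide c t : nonsepmax (c + slide t) = nonsepmax c.
  by rewrite /nonsepmax addrAC project_slide.
split=> // [b c|k _].
  move=> /set_mem /= /eqP bE /set_mem /= /eqP cE bc.
  pose t := b i - c i.
  have ebc : b = c + slide t.
    apply/ffunP => x; rewrite !ffunE.
    have : mass b (p @^-1: [set p x]) = mass c (p @^-1: [set p x]).
      have /ffunP /(_ (p x)) := bc; rewrite !ffunE !massB; lia.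
    have [pxi|pxi] := eqVneq (p x) (p i); last first.
      rewrite fibre_other // /mass !big_set1 => ->.
      have -> : x == i = false by apply: contraNF pxi => /eqP ->.
      have -> : x == j = false by apply: contraNF pxi => /eqP ->; rewrite p_ij.
      by rewrite /= !mulr0 subrr addr0.
    have : x \in [set i; j] by rewrite -fibre_merged !inE pxi.
    rewrite pxi fibre_merged !inE /mass !big_setU1 ?inE // !big_set1 /t.
    have ji : j == i = false by rewrite eq_sym (negPf i_neq_j).
    by case/orP => /eqP ->; rewrite eqxx ?ji ?(negPf i_neq_j) /=;
      move: (b i) (b j) (c i) (c j); lia.
  have t0 : t = 0.
    by move: bE; rewrite ebc sepmax_slide nonsep_slide; lia.
  by rewrite ebc t0; apply/ffunP => x; rewrite !ffunE !mul0r subrr addr0.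
pose b := [ffun x => if x == i then 1 else k (p x)] : {ffun V -> int}.
pose t := sepmax f b i j + 1 - nonsepmax b.
exists (b + slide t) => /=.
  by rewrite /crit sepmax_slide nonsep_slide /t; apply/eqP; lia.
rewrite addrAC project_slide.
apply/ffunP => l; rewrite ffunE -(sK l) massB mass_basis natz !inE.
have [pli|pli] := eqVneq (p (s l)) (p i).
  rewrite pli fibre_merged /mass big_setU1 ?inE // big_set1 !ffunE.
  by rewrite eqxx eq_sym (negPf i_neq_j) p_ij addrC addKr.
rewrite fibre_other // /mass big_set1 ffunE subr0.
by rewrite ifN //; apply: contraNneq pli => ->.
Qed.

(** After sliding the left half of each line by one step, the weights of [f1]
    become those of [f] on two half-lines that overlap in the critical point.
    This point is counted twice, the second time on behalf of the
    contraction. *)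
Theorem point_sum_edge : point_sum u v f1 = point_sum u v f + point_sum u v fc.
Proof.
pose w c := weight u v f (c - basis_vec int i).
have [N wN] := weight_boxed un0 vn0 f.
have wB : boxed N.+1 w.
  move=> c /wN cN x; have := cN x; rewrite !ffunE natz.
  by case: (x == i) => /=; move: (c x); lia.
have condB (Q : pred {ffun V -> int}) :
    boxed N.+1 (fun c => if Q c then w c else 0).
  by move=> c; case: ifP => // _ /wB.
pose R c := sepmax f c i j + 1 <= nonsepmax c.
pose R' c := nonsepmax c <= sepmax f c i j + 1.
have -> : point_sum u v f1 =
    \sum_(c \in [set: {ffun V -> int}]%classic)
      ((if R c then w c else 0) + (if R' c then w c else 0)).
  rewrite (fsumD (condB R) (condB R')).
  rewrite -[X in _ + X](fsum_translate _ (slide 1)).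
  rewrite -(@fsumD _ _ N.+1 N.+2) //.
  - apply: eq_fsbigr => c _; rewrite weight_edge -/(R c).
    have -> : R' (c + slide 1) = ~~ R c.
      rewrite /R' /R sepmax_slide /nonsepmax addrAC project_slide.
      by rewrite -/(nonsepmax c); lia.
    by case: (R c); rewrite /= ?addr0 ?add0r.
  - move=> c /condB cN x; have := cN x; rewrite !ffunE.
    by case: (x == i); case: (x == j) => /=; move: (c x); lia.
transitivity (\sum_(c \in [set: {ffun V -> int}]%classic)
    (w c + (if crit c then w c else 0))).
  apply: eq_fsbigr => c _; rewrite /R /R' /crit.
  by case: ltgtP => _; rewrite ?addr0 ?add0r.
rewrite (fsumD wB (condB crit)) (fsum_translate (weight u v f)); congr +%R.
rewrite /point_sum (reindex_fsbig _ _ _ _ project_crit_bij).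
rewrite [RHS]fsbig_mkcond; apply: eq_fsbigr => c _.
rewrite /patch; case: ifPn => [cc|ncc].
  by rewrite -(weight_crit cc) ifT //; exact: mem_set.
by rewrite ifF //; apply: contraNF ncc => /set_mem.
Qed.

End Contraction.

(** * Forests *)

Section Forests.
Variables (W E : finType) (G : multigraph W E).
Hypothesis G_loopless : loopless G.
Implicit Types (F X D : {set E}) (e : E) (a b x y z : W).

Lemma ends_pair e : exists x y, ends G e = [set x; y].
Proof.
by have /eqP/cards2P[x [y [_ ->]]] := G_loopless e; exists x, y.
Qed.

Lemma adjacentP F x y :
  reflect (exists2 e, e \in F & ends G e = [set x; y]) (adjacent G F x y).
Proof. by apply: (iffP exists_inP) => -[e eF /eqP ee]; exists e. Qed.

Lemma adjacent_sym F : ssrbool.symmetric (adjacent G F).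
Proof.
by move=> x y; apply/adjacentP/adjacentP => -[e eF ee]; exists e => //;
  by rewrite ee setUC.
Qed.

Lemma connect_invariant F (T : eqType) (h : W -> T) x y :
  (forall e a b, e \in F -> ends G e = [set a; b] -> h a = h b) ->
  connect (adjacent G F) x y -> h x = h y.
Proof.
move=> hF /connectP[q + ->]; elim: q x => //= b q IHq a.
by move=> /andP[/adjacentP[e eF ee]] /IHq <-; exact: hF ee.
Qed.

Lemma connect_subset F X x y : F \subset X ->
  connect (adjacent G F) x y -> connect (adjacent G X) x y.
Proof.
move=> /subsetP FX; apply: connect_sub => {x y} x y /adjacentP[e eF ee].
by apply/connect1/adjacentP; exists e => //; apply: FX.
Qed.

(** [r] presents [V] as the quotient of [W] by connectedness in [F]; it keeps
    track of the contraction of the edges of [F]. *)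
Definition labels_components (V : finType) F (r : W -> V) :=
  (forall v, exists w, r w = v) /\
  forall x y, (r x == r y) = connect (adjacent G F) x y.

Lemma components_labels (V : finType) F (r : W -> V) :
  labels_components F r -> components G F = #|V|.
Proof.
move=> [r_surj rE]; rewrite /components /n_comp_mem.
have sym := sym_connect_sym (adjacent_sym F).
rewrite -(card_in_image (f := r)) => [|x y].
  apply: eq_card => v; rewrite [RHS]inE; have [w <-] := r_surj v.
  have -> : r w = r (fingraph.root (adjacent G F) w).
    by apply/eqP; rewrite rE connect_root.
  by apply: image_f; rewrite !inE andbT; apply: roots_root.
rewrite !inE !andbT => /eqP rx /eqP ry /eqP; rewrite rE => xy.
by rewrite -rx -ry; apply/eqP; rewrite root_connect.
Qed.

Lemma labels_components0 : labels_components set0 (@id W).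
Proof.
split=> [v|x y]; first by exists v.
apply/eqP/idP => [->//|]; apply: (connect_invariant (h := id)) => e a b.
by rewrite inE.
Qed.

Lemma labels_components_loop (V : finType) F (r : W -> V) e x y :
  ends G e = [set x; y] -> r x = r y ->
  labels_components F r -> labels_components (e |: F) r.
Proof.
move=> ee rxy [r_surj rE]; split=> // a b; apply/idP/idP => [|ab].
  by rewrite rE; apply/connect_subset/subsetUr.
apply/eqP; apply: connect_invariant ab => e' a' b' /setU1P[->|e'F] ee'.
  have := ee'; rewrite ee => /setP eq; move: (eq a') (eq b').
  by rewrite !inE !eqxx orbT => /orP[]/eqP-> /orP[]/eqP->.
by apply/eqP; rewrite rE; apply/connect1/adjacentP; exists e'.
Qed.

Lemma labels_components_merge (V V' : finType) F (r : W -> V)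
    (p : V -> V') (s : V' -> V) e x y :
  ends G e = [set x; y] -> p (r x) = p (r y) ->
  cancel s p -> (forall v, v != r x -> s (p v) = v) -> r x != r y ->
  labels_components F r -> labels_components (e |: F) (p \o r).
Proof.
move=> ee pxy sK pK rxy [r_surj rE]; split=> [v|a b].
  by have [w rw] := r_surj (s v); exists w; rewrite /= rw sK.
have le a' b' : connect (adjacent G F) a' b' ->
    connect (adjacent G (e |: F)) a' b'.
  by apply/connect_subset/subsetUr.
have sym := sym_connect_sym (adjacent_sym (e |: F)).
have cxy : connect (adjacent G (e |: F)) x y.
  by apply/connect1/adjacentP; exists e; rewrite ?setU11.
have to_y c : p (r c) = p (r x) -> connect (adjacent G (e |: F)) c y.
  move=> pc; have [/eqP|/pK rc] := eqVneq (r c) (r x).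
    by rewrite rE => /le /connect_trans; apply.
  by apply: le; rewrite -rE -rc pc pxy pK // eq_sym.
apply/eqP/idP => /= [pab|ab].
  have [ax|/pK ax] := eqVneq (r a) (r x).
    by apply: connect_trans (to_y a _) _; rewrite ?ax // sym to_y // -pab ax.
  have [bx|/pK bx] := eqVneq (r b) (r x).
    by apply: connect_trans (to_y a _) _; rewrite ?pab ?bx // sym to_y ?bx.
  by apply: le; rewrite -rE -ax -bx pab.
apply: (connect_invariant (h := fun w => p (r w))) ab.
move=> e' a' b' /setU1P[->|e'F] ee'.
  have := ee'; rewrite ee => /setP eq; move: (eq a') (eq b').
  by rewrite !inE !eqxx orbT => /orP[]/eqP-> /orP[]/eqP->.
by congr p; apply/eqP; rewrite rE; apply/connect1/adjacentP; exists e'.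
Qed.

Lemma set_edge_ind (P : {set E} -> Prop) : P set0 ->
  (forall e F, e \notin F -> P F -> P (e |: F)) -> forall F, P F.
Proof.
move=> P0 PU F; have [n] := ubnP #|F|; elim: n F => // n IHn F Fn.
have [->//|[e eF]] := set_0Vmem F.
rewrite -(setD1K eF); apply: PU; first by rewrite !inE eqxx.
by apply: IHn; move: Fn; rewrite (cardsD1 e) eF.
Qed.

Lemma labels_exists F :
  exists (V : finType) (r : W -> V), labels_components F r.
Proof.
elim/set_edge_ind: F => [|e F _ [V [r rF]]].
  by exists W, id; apply: labels_components0.
have [x [y ee]] := ends_pair e.
have [rxy|rxy] := eqVneq (r x) (r y).
  by exists V, r; apply: labels_components_loop ee rxy rF.
have [V' [p [s [pij sK pK]]]] := contraction_exists rxy.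
by exists V', (p \o r); apply: labels_components_merge ee pij sK pK rxy rF.
Qed.

Lemma components_addedge F e x y : ends G e = [set x; y] ->
  components G F =
    (components G (e |: F) + ~~ connect (adjacent G F) x y)%N.
Proof.
move=> ee; have [V [r rF]] := labels_exists F.
rewrite (components_labels rF) -(proj2 rF).
have [rxy|rxy] := eqVneq (r x) (r y).
  by rewrite (components_labels (labels_components_loop ee rxy rF)) addn0.
have [V' [p [s [pij sK pK]]]] := contraction_exists rxy.
rewrite (components_labels (labels_components_merge ee pij sK pK rxy rF)).
by rewrite (card_contraction rxy pij sK pK) addn1.
Qed.

Lemma components_bound F : (#|W| <= #|F| + components G F)%N.
Proof.
elim/set_edge_ind: F => [|e F eF IHF].
  by rewrite (components_labels labels_components0) leq_addl.
have [x [y ee]] := ends_pair e; have := components_addedge F ee.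
rewrite cardsU1 eF => cF; apply: leq_trans IHF _.
by case: connect cF => /=; lia.
Qed.

Lemma components_antitone F X : F \subset X ->
  (components G X <= components G F)%N.
Proof.
move=> /setUidPr <-; rewrite setUC.
elim/set_edge_ind: X => [|e X _ IHX]; first by rewrite set0U.
apply: leq_trans IHX; have [x [y ee]] := ends_pair e.
by rewrite -setUA (components_addedge (X :|: F) ee) leq_addr.
Qed.

Lemma graph_cycle_subset F X c : F \subset X ->
  graph_cycle G F c -> graph_cycle G X c.
Proof.
move=> /subsetP FX /and5P[c0 c1 c2 cF cc]; apply/and5P; split=> //.
by apply/allP => e /(allP cF) /FX.
Qed.

Lemma acyclic_subset F X : F \subset X -> acyclic G X -> acyclic G F.
Proof. by move=> FX aX c; apply: contra (aX c); exact: graph_cycle_subset. Qed.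

Local Notation joins := (fun g h : W * E => ends G g.2 == [set g.1; h.1]).

(** The edges of a path without repeated vertices are distinct: the first one
    contains the starting vertex, the others do not. The last clause is stated
    for arbitrary neighbours [g] and [h] of the walk so that it can be proved
    by induction and then used to close the walk into a cycle. *)
Lemma path_walk F x p : path (adjacent G F) x p -> uniq (x :: p) ->
  exists q : seq (W * E),
  [/\ unzip1 q = belast x p, uniq (unzip2 q),
      forall e, e \in unzip2 q -> e \in F /\ ends G e \subset x :: p &
      forall g h, ends G g.2 = [set g.1; x] -> h.1 = last x p ->
        path joins g (rcons q h)].
Proof.
elim: p x => [|y p IHp] x /=.
  by exists [::]; split=> // g h /= gx hx; rewrite hx gx eqxx.
move=> /andP[/adjacentP[e eF ee] yp] /andP[xyp up].
have [q [q1 q2 qF qp]] := IHp y yp up.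
exists ((x, e) :: q); split=> /=.
- by rewrite q1.
- rewrite q2 andbT; apply/negP => /qF[_ /subsetP /(_ x)].
  by rewrite ee !inE eqxx /= => /(_ isT); apply/negP.
- move=> e'; rewrite inE => /orP[/eqP->|/qF[e'F /subsetP sub]].
    split=> //; rewrite ee; apply/subsetP => z.
    by rewrite !inE => /orP[]/eqP->; rewrite eqxx ?orbT.
  by split=> //; apply/subsetP => z /sub zp; rewrite inE zp orbT.
- by move=> g h gx hp; rewrite gx eqxx /=; apply: qp.
Qed.

Lemma connect_cycle F e x y : e \notin F -> ends G e = [set x; y] ->
  connect (adjacent G F) x y -> exists c, graph_cycle G (e |: F) c.
Proof.
move=> eF ee /connectP[p0 xp0 yE]; move: ee; rewrite yE.
case/shortenP: xp0 => p xp up _ ee.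
have [q [q1 q2 qF qp]] := path_walk xp up.
exists ((last x p, e) :: q); apply/and5P; split=> //=.
- by move: up; rewrite q1 lastI rcons_uniq.
- by rewrite q2 andbT; apply: contra eF => /qF[].
- rewrite setU11; apply/allP => e' /qF[e'F _]; exact: setU1r.
- by apply: qp => //=; rewrite ee setUC.
Qed.

Lemma walk_connect F g h q : path joins g (rcons q h) ->
  all (fun e => e \in F) (unzip2 q) ->
  exists2 w, ends G g.2 = [set g.1; w] & connect (adjacent G F) w h.1.
Proof.
elim: q g => [|g' q IHq] g /=.
  by rewrite andbT => /eqP gh _; exists h.1.
move=> /andP[/eqP gg' g'q] /andP[g'F qF]; exists g'.1 => //.
have [w g'w wh] := IHq g' g'q qF; apply: connect_trans wh.
by apply/connect1/adjacentP; exists g'.2.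
Qed.

Lemma cycle_connect F c : graph_cycle G F c ->
  exists e x y, [/\ e \in F, ends G e = [set x; y] &
                    connect (adjacent G (F :\ e)) x y].
Proof.
case: c => // -[y e] q /and5P[_ _ /= /andP[eq _] /andP[eF qF] cyc].
have [|w ee wy] := @walk_connect (F :\ e) _ _ _ cyc.
  apply/allP => e' e'q; rewrite !inE (allP qF) // andbT.
  by apply: contraNneq eq => <-.
by exists e, w, y; split=> //; rewrite ee setUC.
Qed.

(** Adding an edge to an acyclic set merges two components unless it closes a
    cycle. Conversely, removing an edge of a cycle does not change the number
    of components, so that the bound [components_bound] is strict. *)
Lemma acyclicP F : acyclic G F <-> (#|F| + components G F)%N = #|W|.
Proof.
split=> [|FW c].
  elim/set_edge_ind: F => [|e F eF IHF] aF.
    by rewrite cards0 (components_labels labels_components0).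
  have [x [y ee]] := ends_pair e.
  rewrite -(IHF (acyclic_subset (subsetUr _ _) aF)).
  rewrite (components_addedge F ee) cardsU1 eF; case: (boolP (connect _ _ _)).
    by move=> /(connect_cycle eF ee)[c]; rewrite (negPf (aF c)).
  by rewrite /=; lia.
apply/negP => /cycle_connect[e [x [y [eF ee xy]]]].
have := components_addedge (F :\ e) ee; rewrite setD1K // xy addn0.
have := components_bound (F :\ e); have := cardsD1 e F; rewrite eF; lia.
Qed.

End Forests.

Section InsideCount.
Variables (V E : finType) (h : E -> {set V}).
Implicit Types (D : {set E}) (S T : {set V}).

Definition inside_count D S : int := #|[set e in D | h e \subset S]|%:Z.

Lemma inside_count_supermodular D : supermodular (inside_count D).
Proof.
move=> S T; rewrite /inside_count -!PoszD lez_nat -cardsUI; apply: leq_add.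
  apply: subset_leq_card; apply/subsetP => e; rewrite !inE -andb_orr.
  move=> /andP[-> /orP[]] sub; apply: subset_trans sub _.
    exact: subsetUl.
  exact: subsetUr.
apply: subset_leq_card; apply/subsetP => e; rewrite !inE subsetI.
by case: (e \in D).
Qed.

Lemma inside_count_set0 D : (forall e, h e != set0) ->
  inside_count D set0 = 0.
Proof.
move=> h0; rewrite /inside_count.
rewrite (_ : [set e in D | _] = set0) ?cards0 //.
by apply/setP => e; rewrite !inE subset0 (negPf (h0 e)) andbF.
Qed.

Lemma inside_count_addedge D e S : e \in D ->
  inside_count D S = inside_count (D :\ e) S + (h e \subset S)%:Z.
Proof.
move=> eD; rewrite /inside_count (cardsD1 e) !inE eD /= addrC -PoszD.
by congr (Posz (_ + _)); apply: eq_card => e'; rewrite !inE andbA.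
Qed.

Lemma inside_countT D : inside_count D [set: V] = #|D|%:Z.
Proof.
by congr Posz; apply: eq_card => e; rewrite !inE subsetT andbT.
Qed.

End InsideCount.

Section ForestSum.
Variables (W E : finType) (G : multigraph W E).
Hypothesis G_loopless : loopless G.
Variables (A : comNzRingType) (u v x y : A) (n : nat).
Hypotheses (un0 : u ^+ n = 0) (vn0 : v ^+ n = 0).
Hypotheses (xu : x * (1 - u) = 1) (yv : y * (1 - v) = 1).

(** Without edges the excess is the sum of the negative parts, so the sum is a
    product of the two-sided one-dimensional sums [x + y - 1]. *)
Lemma point_sum0 (V : finType) :
  point_sum u v (fun _ : {set V} => 0) = (x + y - 1) ^+ #|V|.
Proof.
pose zero : {ffun V -> int} := 0.
have mass0 S : mass zero S = 0 by apply: big1 => i _; rewrite ffunE.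
have weightE (c : {ffun V -> int}) :
    weight u v (fun _ => 0) c = \prod_i step_weight u v (c i).
  rewrite (@weight_prod _ _ _ _ _ zero) ?/base ?mass0 //.
  - by apply: eq_bigr => i _; rewrite ffunE subr0.
  - by split=> // S; rewrite mass0.
  apply: excess_eq => // [S|].
    rewrite sub0r -sumrN [leRHS](bigID (mem S)) /= -[leLHS]addr0; apply: lerD.
      by apply: ler_sum => i _; rewrite ffunE; lia.
    by apply: sumr_ge0 => i _; rewrite ffunE; lia.
  exists [set i | c i < 0].
  rewrite sub0r -sumrN [LHS](bigID (mem [set i | c i < 0])) /=.
  rewrite [X in _ + X]big1 ?addr0 => [|i].
    by apply: eq_bigr => i; rewrite inE ffunE; lia.
  by rewrite inE ffunE; lia.
rewrite /point_sum; under eq_fsbigr do rewrite weightE.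
rewrite (@fsum_prod _ _ n (fun _ => step_weight u v)) => [|i t]; last first.
  exact: step_weight_nil.
have := step_sum un0 vn0 xu yv true true; rewrite !mul1r /= => stepE.
rewrite -prodr_const; apply: eq_bigr => i _.
transitivity (1 + (x - 1) + (y - 1)).
  by rewrite -stepE; apply: eq_bigr => k _; rewrite !implybT.
by ring.
Qed.

(** The edges of [F] are already contracted, those of [D] are still to be
    treated. An edge of [D] that has become a loop belongs to no forest
    extending [F]; otherwise the forests not using it and those using it
    correspond to its deletion and to its contraction. *)
Lemma point_sum_forests (V : finType) (r : W -> V) (F D : {set E}) :
  labels_components G F r -> acyclic G F -> [disjoint F & D] ->
  point_sum u v (inside_count (fun e => r @: ends G e) D) =
  \sum_(X : {set E} | [&& F \subset X, X \subset F :|: D & `[< acyclic G X >]])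
     (x + y - 1) ^+ components G X.
Proof.
have [m] := ubnP #|D|; elim: m => // m IHm in V r F D *.
rewrite ltnS => Dm rF aF dFD; have [D0|[e eD]] := set_0Vmem D.
  rewrite (_ : inside_count _ D = fun=> 0); last first.
    apply/funext => S; rewrite /inside_count D0.
    by rewrite (_ : [set e in _ | _] = set0) ?cards0 //;
      apply/setP => e; rewrite !inE.
  rewrite point_sum0 (big_pred1 F) ?(components_labels rF) // => X /=.
  rewrite D0 setU0 andbA -eqEsubset eq_sym.
  by have [->|] := eqVneq X F => //=; apply/asboolP.
have eF : e \notin F.
  by move: dFD; rewrite disjoint_sym => /pred0P /(_ e) /=; rewrite eD => /= ->.
have D'm : (#|D :\ e| < m)%N by move: Dm; rewrite (cardsD1 e D) eD.
have dFD' : [disjoint F & D :\ e].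
  by apply: disjointWr dFD; apply: subD1set.
have [a [b ee]] := ends_pair G_loopless e.
have he : r @: ends G e = [set r a; r b].
  by rewrite ee imsetU1 imset_set1.
have h0 e' : r @: ends G e' != set0.
  have [a' [b' ->]] := ends_pair G_loopless e'.
  by apply/set0Pn; exists (r a'); apply: imset_f; rewrite !inE eqxx.
have sub_he (S : {set V}) :
    (r @: ends G e \subset S) = (r a \in S) && (r b \in S).
  by rewrite he subUset !sub1set.
have without_e : \sum_(X : {set E} |
      [&& F \subset X, X \subset F :|: D & `[< acyclic G X >]] && (e \notin X))
      (x + y - 1) ^+ components G X =
    \sum_(X : {set E} |
      [&& F \subset X, X \subset F :|: (D :\ e) & `[< acyclic G X >]])
      (x + y - 1) ^+ components G X.
  apply: eq_bigl => X.
  have -> : (X \subset F :|: (D :\ e)) = (X \subset F :|: D) && (e \notin X).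
    apply/subsetP/andP => [XFD|[/subsetP XFD eX] e' e'X]; last first.
      have := XFD e' e'X; rewrite !inE => /orP[->//|->].
      by rewrite (memPn eX e' e'X) orbT.
    split; last by apply/negP => /XFD; rewrite !inE eqxx (negPf eF).
    apply/subsetP => e' /XFD; rewrite !inE => /orP[->//|/andP[_ ->]].
    by rewrite orbT.
  by case: (e \notin X); rewrite ?andbT ?andbF.
rewrite (bigID (fun X : {set E} => e \in X)) /= without_e.
have [rab|rab] := eqVneq (r a) (r b).
  rewrite big1 ?add0r => [|X /andP[/and3P[FX _ /asboolP aX] eX]]; last first.
    have aeF : acyclic G (e |: F).
      by apply: acyclic_subset aX; rewrite subUset sub1set eX.
    have := components_addedge G_loopless F ee.
    move/(acyclicP G_loopless): aeF; move/(acyclicP G_loopless): aF.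
    rewrite cardsU1 eF -(proj2 rF) rab eqxx /=; lia.
  rewrite -(IHm _ r) //; apply: point_sum_loop (r a) _ => S.
  by rewrite (inside_count_addedge _ _ eD) sub_he rab andbb.
have [V' [p [s [pij sK pK]]]] := contraction_exists rab.
rewrite addrC -(IHm _ r) //.
have f1E S : inside_count (fun e => r @: ends G e) D S =
    inside_count (fun e => r @: ends G e) (D :\ e) S +
    ((r a \in S) && (r b \in S))%:Z.
  by rewrite (inside_count_addedge _ _ eD) sub_he.
rewrite (point_sum_edge rab pij sK pK (inside_count_supermodular _ _)
  (inside_count_set0 _ h0) f1E un0 vn0).
congr +%R.
have rF' := labels_components_merge ee pij sK pK rab rF.
have aeF : acyclic G (e |: F).
  apply/(acyclicP G_loopless); have := components_addedge G_loopless F ee.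
  move/(acyclicP G_loopless): aF => <-.
  rewrite cardsU1 eF -(proj2 rF) (negPf rab) /=; lia.
have dF' : [disjoint e |: F & D :\ e].
  rewrite disjoints_subset subUset sub1set !inE eqxx /=.
  by rewrite -disjoints_subset.
transitivity (point_sum u v
    (inside_count (fun e => (p \o r) @: ends G e) (D :\ e))).
  congr point_sum; apply/funext => S'; congr Posz; apply: eq_card => e'.
  by rewrite !inE imset_comp [in RHS]sub_imset_pre.
rewrite (IHm _ _ _ _ D'm rF' aeF dF'); apply: eq_bigl => X.
rewrite subUset sub1set -!andbA.
case: (boolP (e \in X)) => eX; last by rewrite !andbF.
by rewrite andbT /= -setUA (setUCA [set e]) setD1K.
Qed.

End ForestSum.

(** * Lattice points of the zonotope *)

Section Orientation.
Variables (V E : finType) (h : E -> {set V}).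
Implicit Types (D : {set E}) (S T : {set V}) (o : E -> V).

Lemma mass_sum (I : finType) (P : pred I) (F : I -> {ffun V -> int}) S :
  mass (\sum_(k | P k) F k) S = \sum_(k | P k) mass (F k) S.
Proof.
by rewrite /mass exchange_big; apply: eq_bigr => i _; rewrite sum_ffunE.
Qed.

Lemma orientation_base o : (forall e, o e \in h e) ->
  base (inside_count h [set: E]) (\sum_e basis_vec int (o e)).
Proof.
move=> oh; have massE S : mass (\sum_e basis_vec int (o e)) S =
    #|[set e | o e \in S]|%:Z.
  rewrite mass_sum -sum1_card (big_morph Posz PoszD (erefl _)) [RHS]big_mkcond.
  by apply: eq_bigr => e _; rewrite mass_basis inE; case: ifP.
split=> [|S].
  by rewrite massE inside_countT; congr Posz; apply: eq_card => e; rewrite !inE.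
rewrite massE lez_nat subset_leq_card //; apply/subsetP => e.
by rewrite !inE => /subsetP; apply; apply: oh.
Qed.

(** By induction, the unit of an edge [ij] can be subtracted at [i] or at [j]
    within the base polytope of the remaining edges. If both failed, there
    would be a tight set containing [i] but not [j] and one containing [j] but
    not [i]; uncrossing them contradicts the inequality for their union, which
    contains the edge. *)
Lemma base_orientation D a : (forall e, #|h e| = 2%N) ->
  base (inside_count h D) a ->
  exists2 o, forall e, o e \in h e & a = \sum_(e in D) basis_vec int (o e).
Proof.
move=> h2; have h_pair e : exists i j, h e = [set i; j].
  by have /eqP/cards2P[i [j [_ ->]]] := h2 e; exists i, j.
have [n] := ubnP #|D|; elim: n => // n IHn in D a *; rewrite ltnS => Dn.
move=> [aT aS]; have [D0|[e eD]] := set_0Vmem D.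
  have f0 S : inside_count h D S = 0.
    apply/eqP; rewrite D0 eqz_nat cards_eq0; apply/eqP/setP => e.
    by rewrite !inE.
  have o_ex e : {i | i \in h e}.
    by apply/sigW/set0Pn; rewrite -card_gt0 h2.
  exists (fun e => sval (o_ex e)) => [e|]; first by case: (o_ex e).
  rewrite D0 big_set0; apply/ffunP => i; rewrite ffunE.
  have := aS [set i]; have := aS (~: [set i]); have := massD1 a i.
  by rewrite aT !f0 {3}/mass big_set1; lia.
have [i [j hij]] := h_pair e.
have D'n : (#|D :\ e| < n)%N by move: Dn; rewrite (cardsD1 e D) eD.
have fE S : inside_count h D S =
    inside_count h (D :\ e) S + ((i \in S) && (j \in S))%:Z.
  by rewrite (inside_count_addedge _ _ eD) hij subUset !sub1set.
have toward k : k \in h e ->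
    base (inside_count h (D :\ e)) (a - basis_vec int k) ->
    exists2 o, forall e, o e \in h e & a = \sum_(e in D) basis_vec int (o e).
  move=> ke /(IHn _ _ D'n)[o oh aE].
  exists (fun e' => if e' == e then k else o e') => [e'|].
    by case: eqP => [->|].
  rewrite (big_setD1 e) //= eqxx -[LHS](subrK (basis_vec int k)) aE addrC.
  congr (_ + _); apply: eq_bigr => e'; rewrite !inE => /andP[/negPf -> _] //.
have [fi|nfi] := pselect (base (inside_count h (D :\ e)) (a - basis_vec int i)).
  by apply: (toward i _ fi); rewrite hij !inE eqxx.
apply: (toward j); first by rewrite hij !inE eqxx orbT.
have massE k S : mass (a - basis_vec int k) S = mass a S - (k \in S)%:Z.
  by rewrite massB mass_basis natz.
split=> [|T]; first by rewrite massE aT fE !inE; lia.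
rewrite leNgt; apply/negP => Tj; apply: nfi.
split=> [|S]; first by rewrite massE aT fE !inE; lia.
rewrite leNgt; apply/negP => Si; move: Tj Si; rewrite !massE.
have := inside_count_supermodular h (D :\ e) S T; have := massUI a S T.
have := aS S; have := aS T; have := aS (S :&: T); have := aS (S :|: T).
rewrite !fE !inE.
by case: (i \in S); case: (j \in S); case: (i \in T); case: (j \in T) => /=;
  lia.
Qed.

End Orientation.

Section Zonotope.
Variables (R : realType) (W E : finType) (G : multigraph W E).
Hypothesis G_loopless : loopless G.
Implicit Types (S p : {set W}) (z : {ffun W -> R^o}).

Definition rmass z S : R := \sum_(i in S) z i.

Lemma rmass_basis i S : rmass (basis_vec R^o i) S = (i \in S)%:R.
Proof.
rewrite /rmass; under eq_bigr do rewrite ffunE.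
have [iS|iS] := boolP (i \in S); last first.
  by rewrite big1 // => j jS; rewrite [_ == _](negPf (memPn iS j jS)).
by rewrite (bigD1 i iS) /= eqxx big1 ?addr0 // => j /andP[_ /negPf] ->.
Qed.

Lemma edge_segment_rmass p z S : edge_segment R p z ->
  (p \subset S)%:R <= rmass z S /\ rmass z [set: W] = 1.
Proof.
move=> [i [j [-> [t /andP[t0 t1] <-]]]].
have rE T : rmass ((1 - t) *: basis_vec R^o i + t *: basis_vec R^o j) T =
    (1 - t) * (i \in T)%:R + t * (j \in T)%:R.
  rewrite -!rmass_basis /rmass !mulr_sumr -big_split.
  by apply: eq_bigr => k _; rewrite !ffunE.
rewrite !rE !inE !mulr1 subrK subUset !sub1set; split=> //.
by case: (i \in S); case: (j \in S); rewrite /= ?mulr1 ?mulr0; lra.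
Qed.

Lemma sum_multiplicity S :
  inside_count (ends G) [set: E] S =
  \sum_(p in [set p : {set W} | #|p| == 2%N])
    ((multiplicity G p) * (p \subset S))%N%:Z.
Proof.
rewrite -(big_morph Posz PoszD (erefl _)); congr Posz.
rewrite -sum1_card.
rewrite (partition_big (ends G) (mem [set p : {set W} | #|p| == 2%N])) /=.
  apply: eq_bigr => p _; rewrite sum1_card /multiplicity.
  have [pS|pS] := boolP (p \subset S); rewrite ?muln1 ?muln0.
    apply: eq_card => e; rewrite !inE unfold_in /= !inE.
    by case: eqP => [->|]; rewrite ?pS ?andbF.
  apply: eq_card0 => e; rewrite unfold_in /= !inE.
  by case: eqP => [->|]; rewrite ?andbF // (negPf pS).
by move=> e _; rewrite inE G_loopless.
Qed.

(** The defining inequalities of the base polytope hold for each segment,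
    hence for the Minkowski sum. Conversely, an integer point comes from an
    orientation, and the edges with endpoints [i] and [j] contribute a point
    of the dilated segment, its position being the proportion of these edges
    directed towards [j]. *)
Lemma zonotope_lattice_base :
  zonotope_lattice R G = base (inside_count (ends G) [set: E]).
Proof.
apply/predeqP => a; split.
  move=> [g gP gE].
  have massE S : (mass a S)%:~R =
      \sum_(p in [set p : {set W} | #|p| == 2%N]) rmass (g p) S :> R.
    rewrite /rmass exchange_big /mass rmorph_sum; apply: eq_bigr => i _ /=.
    by move/ffunP/(_ i): gE; rewrite sum_ffunE ffunE => ->.
  have gmass p S : p \in [set p : {set W} | #|p| == 2%N] ->
      (multiplicity G p * (p \subset S))%N%:R <= rmass (g p) S /\
      rmass (g p) [set: W] = (multiplicity G p)%:R.
    move=> /gP [x /(@edge_segment_rmass _ _) xS <-].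
    have rE T : rmass ((multiplicity G p)%:R *: x) T =
        (multiplicity G p)%:R * rmass x T.
      by rewrite /rmass mulr_sumr; apply: eq_bigr => k _; rewrite !ffunE.
    rewrite !rE natrM (proj2 (xS S)) mulr1; split=> //.
    by apply: ler_wpM2l; [exact: ler0n|exact: (proj1 (xS S))].
  split=> [|S].
    apply/eqP; rewrite -(eqr_int R) massE sum_multiplicity rmorph_sum /=.
    apply/eqP/eq_bigr => p pD; have [_ ->] := gmass p set0 pD.
    by rewrite subsetT muln1.
  rewrite -(ler_int R) massE sum_multiplicity rmorph_sum /=.
  by apply: ler_sum => p pD; have [] := gmass p S pD.
move=> /(base_orientation G_loopless)[o oG aE].
exists (fun p => \sum_(e | ends G e == p) basis_vec R^o (o e)).
  move=> p; rewrite inE => /cards2P[i [j [ij pij]]].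
  pose n k := #|[pred e | (ends G e == p) && (o e == k)]|.
  have oE e : ends G e == p -> (o e != i) = (o e == j).
    move=> /eqP ep; have := oG e; rewrite ep pij !inE => /orP[]/eqP->.
      by rewrite eqxx (negPf ij).
    by rewrite eqxx eq_sym.
  have mE : multiplicity G p = (n i + n j)%N.
    rewrite /multiplicity -sum1_card (bigID (fun e => o e == i)) /= !sum1_card.
    congr addn; apply: eq_card => e; rewrite unfold_in [RHS]inE /= inE //.
    by case: (boolP (ends G e == p)) => //= /oE ->.
  have sE : \sum_(e | ends G e == p) basis_vec R^o (o e) =
      (n i)%:R *: basis_vec R^o i + (n j)%:R *: basis_vec R^o j.
    rewrite (bigID (fun e => o e == i)) /=; congr (_ + _).
      rewrite (eq_bigr (fun=> basis_vec R^o i)) => [|e /andP[_ /eqP->//]].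
      by rewrite sumr_const scaler_nat.
    rewrite (eq_big (fun e => (ends G e == p) && (o e == j))
      (fun=> basis_vec R^o j)).
    - by rewrite sumr_const scaler_nat.
    - by move=> e; case: (boolP (ends G e == p)) => //= /oE ->.
    - by move=> e /andP[ep]; rewrite (oE _ ep) => /eqP ->.
  (* Without edges between [i] and [j] the proportion is undefined, and any
     point of the segment serves. *)
  rewrite sE mE; have [n0|n0] := eqVneq (n i + n j)%N 0%N.
    exists (basis_vec R^o i).
      exists i, j; split=> //; exists 0; rewrite /= ?lexx ?ler01 //.
      by rewrite subr0 scale1r scale0r addr0.
    have [-> ->] : n i = 0%N /\ n j = 0%N by lia.
    by rewrite addn0 !scale0r addr0.
  have m0 : (n i + n j)%N%:R != 0 :> R by rewrite pnatr_eq0.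
  pose t : R := (n j)%:R / (n i + n j)%N%:R.
  exists ((1 - t) *: basis_vec R^o i + t *: basis_vec R^o j).
    exists i, j; split=> //; exists t => //=; rewrite /t divr_ge0 ?ler0n //=.
    by rewrite ler_pdivrMr ?mul1r ?ler_nat ?leq_addl // ltr0n lt0n.
  rewrite scalerDr !scalerA /t; congr (_ *: _ + _ *: _).
    by rewrite mulrBr mulrCA mulfV // !mulr1 natrD addrK.
  by rewrite mulrCA mulfV // mulr1.
transitivity (\sum_e basis_vec R^o (o e)).
  rewrite [RHS](partition_big (ends G)
    (mem [set p : {set W} | #|p| == 2%N])) //=.
  by move=> e _; rewrite inE G_loopless.
apply/ffunP => i; rewrite ffunE aE !sum_ffunE rmorph_sum.
apply: eq_big => [e|e _]; first by rewrite inE.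
by rewrite !ffunE; case: eqP.
Qed.

Lemma zonotope_polymatroid : polymatroid (zonotope_lattice R G).
Proof.
rewrite zonotope_lattice_base; split.
- exact: finite_base.
- have o_ex e : {i | i \in ends G e}.
    by apply/sigW/set0Pn; rewrite -card_gt0 G_loopless.
  exists (\sum_e basis_vec int (sval (o_ex e))).
  by apply: orientation_base => e; case: (o_ex e).
- move=> a b fa fb i ba.
  apply: base_exchange fa fb ba; first exact: inside_count_supermodular.
  by apply: inside_count_set0 => e; rewrite -card_gt0 G_loopless.
Qed.

End Zonotope.

(** * Separating polynomials by their values in finite rings *)

Section Separation.

Lemma poly_roots_eq0 (A : idomainType) (q : {poly A}) (g : nat -> A) :
  injective g -> (forall k, q.[g k] = 0) -> q = 0.
Proof.
move=> g_inj qg; apply: (@roots_geq_poly_eq0 _ _ (map g (iota 0 (size q)))).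
- by apply/allP => _ /mapP[k _ ->]; apply/rootP.
- by rewrite map_inj_uniq ?iota_uniq.
- by rewrite size_map size_iota.
Qed.

Let odd_int (k : nat) : int := (2 * k).+1%:Z.
Let point (k l : nat) (i : 'I_2) : int := odd_int (if i == ord0 then k else l).

(** As a polynomial in one variable over the polynomials in the other, [p] has
    infinitely many roots, because its value at each of them has infinitely
    many roots in the other variable. *)
Lemma mpoly2_eq0 (p : {mpoly int[2]}) :
  (forall k l, p.@[point k l] = 0) -> p = 0.
Proof.
move=> p0.
pose Q : {poly {poly int}} :=
  \sum_(m <- msupp p) ((p@_m *: 'X^(m ord_max))%:P * 'X^(m ord0)).
have QE k l : Q.[(odd_int k)%:P].[odd_int l] = p.@[point k l].
  rewrite mevalE /Q !horner_sum; apply: eq_bigr => m _.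
  rewrite !hornerE big_ord_recl big_ord1 -mulrA [_ ^+ _ * _]mulrC.
  by rewrite (_ : lift _ _ = ord_max) //; apply: val_inj.
have odd_inj : injective odd_int by move=> k l; rewrite /odd_int; lia.
have Q0 : Q = 0.
  apply: (@poly_roots_eq0 _ _ (fun k => (odd_int k)%:P)) => [k l|k].
    by move/polyC_inj/odd_inj.
  by apply: poly_roots_eq0 odd_inj _ => l; rewrite QE.
apply/mpolyP => m; rewrite mcoeff0.
have : Q`_(m ord0)`_(m ord_max) = 0 by rewrite Q0 !coef0.
rewrite /Q !coef_sum => <-.
have mE (m' : 'X_{1..2}) :
    (m ord0 == m' ord0) && (m ord_max == m' ord_max) = (m' == m).
  apply/andP/eqP => [[/eqP e0 /eqP e1]|->]; last by rewrite !eqxx.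
  apply/mnmP => i; have [->|->] : i = ord0 \/ i = ord_max; rewrite ?e0 ?e1 //.
  by case: i => [[|[|]]] // ?; [left|right]; apply: val_inj.
have termE (m' : 'X_{1..2}) :
    ((p@_m' *: 'X^(m' ord_max))%:P * 'X^(m' ord0) : {poly {poly int}})
      `_(m ord0)`_(m ord_max) =
    if m' == m then p@_m' else 0.
  rewrite coefCM coefXn -mE; case: eqP => _ /=; last by rewrite mulr0 coef0.
  by rewrite mulr1 coefZ coefXn; case: eqP; rewrite ?mulr1 ?mulr0.
under eq_bigr do rewrite termE.
have [mp|mp] := boolP (m \in msupp p).
  rewrite (bigD1_seq m) ?msupp_uniq //= eqxx big1 ?addr0 // => m' /negPf ->.
  by [].
rewrite (memN_msupp_eq0 mp) big1_seq // => m' /= m'p.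
by case: eqP mp => // <-; rewrite m'p.
Qed.

(** Given odd values of the variables, evaluate modulo [2 ^ n]: there
    [1 - 1 / w] is nilpotent for odd [w], because [w - 1] is even. The value
    of [p] is then an integer divisible by [2 ^ n], and it is zero once [n]
    exceeds its size. *)
Lemma mpoly2_separated (p : {mpoly int[2]}) :
  (forall (A : comNzRingType) (phi : {rmorphism {mpoly int[2]} -> A})
     (u v : A) (n : nat), u ^+ n = 0 -> v ^+ n = 0 ->
     phi varx * (1 - u) = 1 -> phi vary * (1 - v) = 1 -> phi p = 0) ->
  p = 0.
Proof.
move=> p_phi; apply: mpoly2_eq0 => k l.
pose z := p.@[point k l]; pose n := (absz z).+1.
have n1 : (1 < 2 ^ n)%N by rewrite -{1}(expn0 2) ltn_exp2l.
pose phi : {rmorphism {mpoly int[2]} -> 'Z_(2 ^ n)} :=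
  intr \o meval (point k l).
pose w (a : nat) : 'Z_(2 ^ n) := (2 * a).+1%:R.
have w_unit a : w a \is a GRing.unit.
  by rewrite unitZpE // coprimeXl // coprime2n /= oddM.
have w_nil a : (1 - (w a)^-1) ^+ n = 0.
  have -> : 1 - (w a)^-1 = (2 * a)%:R / w a.
    apply: (mulIr (w_unit a)); rewrite mulrBl mul1r mulVr // divrK //.
    by rewrite /w mulrSr addrK.
  by rewrite exprMn -natrX expnMn natrM pchar_Zp // !mul0r.
have w_inv a : w a * (1 - (1 - (w a)^-1)) = 1.
  by rewrite opprB addrC subrK divrr.
have xE : phi varx = w k by rewrite /phi /= mevalXU.
have yE : phi vary = w l by rewrite /phi /= mevalXU.
have := p_phi _ phi _ _ _ (w_nil k) (w_nil l).
rewrite xE yE => /(_ (w_inv k) (w_inv l)) /=; rewrite -/z => z0.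
have : ((absz z)%:R : 'Z_(2 ^ n)) = 0.
  case: (intP z) z0 => // m; rewrite abszN mulrNz => /eqP.
  by rewrite oppr_eq0 => /eqP.
move=> /(congr1 val) /=; rewrite val_Zp_nat // modn_small.
  by move/eqP; rewrite absz_eq0 => /eqP.
exact: ltn_trans (ltnSn _) (ltn_expl _ _).
Qed.

End Separation.

(** * The Tutte polynomials as sums over forests *)

Section Main.
Variables (R : realType) (d : Order.disp_t) (W : finOrderType d).
Variables (E : finType) (G : multigraph W E).
Hypothesis G_loopless : loopless G.

Lemma prod_activities (A : comPzRingType) (I J : {set W}) (x y : A) :
  x ^+ #|I :\: J| * y ^+ #|J :\: I| * (x + y - 1) ^+ #|I :&: J| =
  \prod_i (1 + (i \in I)%:R * (x - 1) + (i \in J)%:R * (y - 1)).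
Proof.
rewrite -!prodr_const [X in X * _ * _]big_mkcond [X in _ * X * _]big_mkcond.
rewrite [X in _ * X]big_mkcond -!big_split; apply: eq_bigr => i _ /=.
by rewrite !inE; case: (i \in I); case: (i \in J); rewrite /=; ring.
Qed.

Lemma polymatroid_tutte_forests :
  polymatroid_tutte (zonotope_lattice R G) =
    \sum_(F : {set E} | `[< acyclic G F >])
      (varx + vary - 1) ^+ components G F.
Proof.
apply/eqP; rewrite -subr_eq0; apply/eqP/mpoly2_separated.
move=> A phi u v n un0 vn0 xu yv.
apply/eqP; rewrite rmorphB subr_eq0; apply/eqP.
pose f := inside_count (ends G) [set: E].
have f_super : supermodular f by apply: inside_count_supermodular.
have f0 : f set0 = 0.
  by apply: inside_count_set0 => e; rewrite -card_gt0 G_loopless.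
have [_ f_ex _] := zonotope_polymatroid R G_loopless.
rewrite zonotope_lattice_base // in f_ex *.
rewrite /polymatroid_tutte fsbig_finite; last exact: finite_base.
rewrite rmorph_sum /=.
under eq_bigr => a _ do (rewrite prod_activities rmorph_prod /=;
  under eq_bigr do rewrite !(rmorphD, rmorphM, rmorphN, rmorph1, rmorph_nat)).
rewrite -(fsbig_finite _ _ (finite_base f)) /=.
rewrite -(point_sum_cones f_super f0 un0 vn0 xu yv f_ex).
transitivity (point_sum u v (inside_count (fun e => id @: ends G e) [set: E])).
  congr point_sum; apply/funext => S; congr Posz; apply: eq_card => e.
  by rewrite !inE imset_id.
have a0 : acyclic G set0.
  apply/(acyclicP G_loopless).
  by rewrite cards0 (components_labels (labels_components0 G)).
rewrite (point_sum_forests G_loopless un0 vn0 xu yv (labels_components0 G) a0).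
  rewrite rmorph_sum; apply: eq_big => [F|F _].
    by rewrite sub0set setUT subsetT.
  by rewrite rmorphXn !rmorphE.
by rewrite disjoints_subset sub0set.
Qed.

(** The factor [y - 1] becomes zero, so only the sets of vanishing nullity
    remain. *)
Lemma tutte_forests :
  (varx + vary - 1) ^+ components G [set: E] *
    (tutte G \mPo [tuple varx + vary; 1]) =
  \sum_(F : {set E} | `[< acyclic G F >])
    (varx + vary - 1) ^+ components G F.
Proof.
rewrite /tutte rmorph_sum /= mulr_sumr [RHS]big_mkcond; apply: eq_bigr => F _.
rewrite !rmorphM !rmorphXn !rmorphB !rmorph1 /= !comp_mpolyXU.
rewrite /= subrr.
have cF := components_antitone G_loopless (subsetT F).
rewrite mulrA -exprD subnKC // expr0n.
have bound := components_bound G_loopless F; rewrite subn_eq0.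
case: asboolP => [/(acyclicP G_loopless) ->|nF]; first by rewrite leqnn mulr1.
rewrite leqNgt ltn_neqAle bound andbT.
case: eqP => [WF|]; last by rewrite mulr0.
by case: nF; apply/(acyclicP G_loopless).
Qed.

End Main.

Local Open Scope classical_set_scope.
Local Open Scope ring_scope.

Theorem theorem16p1 (R : realType) (d : Order.disp_t) (W : finOrderType d)
    (E : finType) (G : multigraph W E) (k : nat)
    (G_loopless : loopless G)
    (G_comp : components G [set: E]%SET = k)
    (G_edge : (0 < #|E|)%N) :
  [/\ polymatroid (zonotope_lattice R G),
      polymatroid_tutte (zonotope_lattice R G) =
        (varx + vary - 1) ^+ k * (tutte G \mPo [tuple varx + vary; 1]) &
      polymatroid_tutte (zonotope_lattice R G) =
        \sum_(F : {set E} | `[< acyclic G F >])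
          (varx + vary - 1) ^+ components G F].
Proof.
split; first exact: zonotope_polymatroid.
  by rewrite -G_comp tutte_forests // polymatroid_tutte_forests.
exact: polymatroid_tutte_forests.
Qed.
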